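(* Let $V$ be a finite set, $\mathcal C=\{C_1,\dots,C_r\}$ a partition of $V$, let $\mathcal S_j$ ($j\in V$) be finite sets, $\mathcal S_{C_h}=\prod_{j\in C_h}\mathcal S_j$, and $\mathcal S=\prod_{h=1}^r\mathcal S_{C_h}$. Let $G=(\mathcal S,E)$ be a connected $\mathcal C$-decomposable graph with $\mathcal C$-decomposition $(G_1,\dots,G_r)$, $G_h=(\mathcal S_{C_h},E_h)$. Let $\mu=\prod_{h=1}^r\mu_{C_h}$ be a product distribution, where $\mu_{C_h}$ is a probability distribution on $\mathcal S_{C_h}$. Let $N=|\mathcal S|$, and for each $h$ let $(t^{(C_h)}_\ell:\ell\in\mathbb N)$ be an increasing sequence of times such that, for some constant $c>0$, $$\min_{h=1,\dots,r}\left(t^{(C_h)}_{\ell+1}-t^{(C_h)}_\ell\right)\ge c\,\ell^{5N-1}.$$ Consider $r$ independent Markov chains $X_{C_1},\dots,X_{C_r}$, where $X_{C_h}=(X_{C_h}(t):t\in\mathbb N)$ has state space $\mathcal S_{C_h}$, arbitrary initial distribution, and transition matrix at time $t$ $$P_{C_h}(t)=\sum_{k=1}^\infty P^{(\mu_{C_h,k},G_h)}\,\mathbf 1_{\{t\in[t^{(C_h)}_k,\,t^{(C_h)}_{k+1})\}},$$ with $\mu_{C_h,k}$ and $P^{(\mu_{C_h,k},G_h)}$ given by the construction described in the context. Let $X(t)=(X_{C_1}(t),\dots,X_{C_r}(t))$, $t\in\mathbb N$. Then, almost surely, $$\lim_{t\to\infty}\frac1t\sum_{m=0}^{t-1}\mathbf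 1_{\{X(m)=s\}}=\lim_{t\to\infty}\frac1t\sum_{m=0}^{t-1}\prod_{h=1}^r\mathbf 1_{\{X_{C_h}(m)=s_{C_h}\}}=\prod_{h=1}^r\mu_{C_h}(s_{C_h})=\mu(s)$$ for each $s=(s_{C_1},\dots,s_{C_r})\in\mathcal S$.
   Context: Two vertices of a graph are adjacent if they are equal or joined by an edge. $\mathcal C$-decomposability. A connected finite graph $G=(\mathcal S,E)$ is $\mathcal C$-decomposable, with $\mathcal C$-decomposition $(G_1,\dots,G_r)$, $G_h=(\mathcal S_{C_h},E_h)$, if $G$ is the strong product $G_1\otimes\cdots\otimes G_r$, i.e. $(s_{C_1},\dots,s_{C_r})$ and $(\bar s_{C_1},\dots,\bar s_{C_r})$ are adjacent in $G$ if and only if $s_{C_\ell}$ and $\bar s_{C_\ell}$ are adjacent in $G_\ell$ for every $\ell=1,\dots,r$. Construction. It is described for a finite connected graph $H=(\mathcal T,F)$ with $n=|\mathcal T|$ vertices and a probability distribution $\nu$ on $\mathcal T$, and is set up under the assumption that the subgraph of $H$ induced by the support of $\nu$ is not connected (hence $n\ge3$ and the sets $\mathcal A_k$ below are non-empty). It is applied, for each $h$, with $(\mathcal T,H,\nu)=(\mathcal S_{C_h},G_h,\mu_{C_h})$, giving $\mu_{C_h,k}=\nu_k$ and $P^{(\mu_{C_h,k},G_h)}=P^{(\nu_k,H)}$. Distributions $\nu_k$: for $k\ge1$ let $\mathcal A_k=\{s\in\mathcal T:\nu(s)<1/k\}$, let $\eta_k$ be the uniform distribution on $\mathcal A_k$,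 and let $$\nu_k=\frac1k\,\eta_k+\frac{k-1}{k}\,\nu .$$ Matrices $P^{(\nu_k,H)}$: label $\mathcal T=\{s^1,\dots,s^n\}$ so that $\nu(s^1)\ge\cdots\ge\nu(s^n)$; for $k>1/\min\{\nu(s)>0:s\in\mathcal T\}$ one then has $\nu_k(s^1)\ge\cdots\ge\nu_k(s^n)>0$. Set $P^{(\nu_k,H)}=(p_{l,m})_{l,m=1,\dots,n}$ with $$p_{l,m}=\begin{cases}p,& l<m,\ \{s^l,s^m\}\in F,\\ \frac{\nu_k(s^m)}{\nu_k(s^l)}\,p,& l>m,\ \{s^l,s^m\}\in F,\\ 1-p\,D_l,& l=m,\\ 0,&\text{otherwise,}\end{cases}$$ where $$D_l=\sum_{m'>l}\mathbf 1_{\{\{s^l,s^{m'}\}\in F\}}+\sum_{m'<l}\frac{\nu_k(s^{m'})}{\nu_k(s^l)}\mathbf 1_{\{\{s^l,s^{m'}\}\in F\}},\qquad p=\min_{l=1,\dots,n}\frac1{2D_l}.$$ *)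

(* Defs.v *)
(* MathComp-Analysis *)
From HB Require Import structures.
From mathcomp Require Import all_boot all_order all_algebra.
From mathcomp Require Import all_classical all_reals all_analysis.

Set Implicit Arguments.
Unset Strict Implicit.
Unset Printing Implicit Defensive.

Import Order.TTheory GRing.Theory Num.Theory.
Import numFieldNormedType.Exports.

Local Open Scope ring_scope.

Definition simple_graph (T : finType) (e : rel T) : Prop :=
  symmetric e /\ irreflexive e.

Definition connected_graph (T : finType) (e : rel T) : Prop :=
  forall x y : T, connect e x y.

Definition adjacent (T : finType) (e : rel T) (x y : T) : bool :=
  (x == y) || e x y.

Definition induced_subgraph (T : finType) (e : rel T) (A : {pred T}) :
  rel {x : T | x \in A} := fun x y => e (val x) (val y).
Arguments induced_subgraph {T} e A.

Definition C_decomposition (I : finType) (T : I -> finType)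
    (e : rel {dffun forall i, T i}) (eC : forall i, rel (T i)) : Prop :=
  forall s s' : {dffun forall i, T i},
    adjacent e s s' <-> forall i, adjacent (eC i) (s i) (s' i).

(* S_C = prod_(j in C) S_j *)
Definition block_space (V : finType) (S : V -> finType) (C : {set V}) :
  finType := {dffun forall j : {j : V | j \in C}, S (val j)}.

Section Construction.
Variables (R : realType) (T : finType).

Definition is_distribution (nu : T -> R) : Prop :=
  (forall x, 0 <= nu x) /\ \sum_(x : T) nu x = 1.

Definition dsupport (nu : T -> R) : {pred T} := [pred x | 0 < nu x].

Definition low_set (nu : T -> R) (k : nat) : {set T} :=
  [set x | nu x < k%:R^-1]%SET.

(* Junk value 0 when low_set nu k is empty, which cannot happen if the support
   of nu induces a disconnected subgraph of a connected graph. *)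
Definition low_uniform (nu : T -> R) (k : nat) (x : T) : R :=
  (x \in low_set nu k)%:R / #|low_set nu k|%:R.

Definition perturbed (nu : T -> R) (k : nat) (x : T) : R :=
  k%:R^-1 * low_uniform nu k x + (k%:R - 1) / k%:R * nu x.

(* lab x is the index l (from 0) such that x = s^l; an injection of T into
   'I_#|T| is a bijection. Ties may be broken arbitrarily. *)
Definition decreasing_labelling (nu : T -> R) (lab : T -> 'I_#|T|) : Prop :=
  injective lab /\ forall x y, (lab x <= lab y)%N -> nu y <= nu x.

Variables (lab : T -> 'I_#|T|) (e : rel T) (rho : T -> R).

Definition label_degree (x : T) : R :=
  \sum_(y : T | (lab x < lab y)%N) (e x y)%:R
  + \sum_(y : T | (lab y < lab x)%N) rho y / rho x * (e x y)%:R.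

(* The set is finite and nonempty, so inf is its minimum. *)
Definition base_rate : R :=
  inf (range (fun x : T => (2 * label_degree x)^-1)).

Definition reversible_matrix (x y : T) : R :=
  if x == y then 1 - base_rate * label_degree x
  else if e x y then
    if (lab x < lab y)%N then base_rate else rho y / rho x * base_rate
  else 0.

End Construction.

(* Value at time t of the piecewise constant matrix equal to
   P^(nu_k, H) on [tau k, tau k.+1), k >= 1. It vanishes for t < tau 1, so it
   is stochastic at every time only if tau 1 = 0; tau 0 is not used. *)
Definition switching_matrix (R : realType) (T : finType) (nu : T -> R)
    (lab : T -> 'I_#|T|) (e : rel T) (tau : nat -> nat) (t : nat) (x y : T) : R :=
  \big[+%R/0]_(1 <= k <oo)
    (reversible_matrix lab e (perturbed nu k) x y
    * (tau k <= t < tau k.+1)%N%:R).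

Section Probability.
Variables (d : measure_display) (Om : measurableType d) (R : realType).
Variable P : probability Om R.
Local Open Scope classical_set_scope.

Definition cond_prob (A B : set Om) : R := fine (P (A `&` B)) / fine (P B).

Definition finite_rv (T : finType) (Y : Om -> T) : Prop :=
  forall x : T, measurable (Y @^-1` [set x]).

Definition Markov_chain (T : finType) (Q : nat -> T -> T -> R)
    (Y : nat -> Om -> T) : Prop :=
  (forall t, finite_rv (Y t)) /\
  forall (t : nat) (x : nat -> T),
    let past := [set w | forall i, (i <= t)%N -> Y i w = x i] in
    P past != 0%E ->
    cond_prob (Y t.+1 @^-1` [set x t.+1]) past = Q t (x t) (x t.+1).

Definition sigma_process (T : finType) (Y : nat -> Om -> T) : set (set Om) :=
  <<s [set A | exists t x, A = Y t @^-1` [set x]] >>.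

Definition independent_processes (I : finType) (T : I -> finType)
    (Y : forall i, nat -> Om -> T i) : Prop :=
  forall (J : {set I}) (A : I -> set Om),
    (forall i, i \in J -> sigma_process (Y i) (A i)) ->
    fine (P (\bigcap_(i in [set` J]) A i)) = \prod_(i in J) fine (P (A i)).

End Probability.

(* Main.v *)
(* Each block chain is contracting: every entry of its transition matrices along
   an edge or on the diagonal is at least const/k^2 on the k-th time interval,
   and H is connected, so any |T| consecutive steps up to that interval shrink
   the oscillation of a function by the factor 1 - const/k^(2|T|). Consequences:
   - the k-th interval is so long (at least c k^(5N-1) steps) that the law of the
     chain during the next interval is O(1/k)-close to nu, since nu_k is
     stationary and nu_k -> nu;
   - before time j^4 the interval index satisfies k^(2|T|) = O(j^2), hence
     sum_t |cov(1{X_h(m) = s}, 1{X_h(t) = s})| = O(j^2) over m <= t < j^4.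
   By independence of the blocks both facts pass to the joint process (covariances
   of products are bounded by sums of covariances). So the average of the centered
   indicators up to time j^4 has second moment O(j^-2); these are summable, whence
   almost sure convergence along t = j^4, and the gaps between consecutive fourth
   powers are negligible. *)
Require Import Defs.
From HB Require Import structures.
From mathcomp Require Import all_boot all_order all_algebra.
From mathcomp Require Import all_classical all_reals all_analysis.
From mathcomp Require Import measurable_realfun zify ring lra.

Set Implicit Arguments.
Unset Strict Implicit.
Unset Printing Implicit Defensive.

Import Order.TTheory GRing.Theory Num.Theory.
Import numFieldNormedType.Exports.

Local Open Scope classical_set_scope.
Local Open Scope ring_scope.

(** * Contraction of time-dependent stochastic matrices *)

Section Propagation.
Variables (R : realType) (T : finType).
Implicit Types (Q : nat -> T -> T -> R) (f : T -> R).

(** The product of the matrices [Q m], ..., [Q (m + L - 1)] applied to the column [f]: the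
    expectation of [f] at time [m + L] for a chain that sits at [x] at time [m]. *)
Fixpoint propagate Q m L f x : R :=
  if L is L'.+1 then \sum_y Q m x y * propagate Q m.+1 L' f y else f x.

Definition stochastic (A : T -> T -> R) : Prop :=
  (forall x y, 0 <= A x y) /\ forall x, \sum_y A x y = 1.

Lemma propagateD Q m L L' f x :
  propagate Q m (L + L') f x = propagate Q m L (propagate Q (m + L) L' f) x.
Proof.
elim: L m x => [|L IH] m x /=; first by rewrite addn0.
by apply: eq_bigr => y _; rewrite IH addSnnS.
Qed.

Lemma propagateZD Q m L f g a x :
  propagate Q m L (fun y => a * f y + g y) x =
  a * propagate Q m L f x + propagate Q m L g x.
Proof.
elim: L m x => [|L IH] m x //=.
by rewrite mulr_sumr -big_split; apply: eq_bigr => y _; rewrite IH /=; ring.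
Qed.

Section Window.
Variables (Q : nat -> T -> T -> R) (m L : nat).
Hypothesis Qstoch : forall t, (m <= t < m + L)%N -> stochastic (Q t).

Lemma propagate_cst a x : propagate Q m L (fun=> a) x = a.
Proof.
elim: L m x Qstoch => [|l IH] k x H //=.
rewrite (eq_bigr (fun y => Q k x y * a)) => [|y _].
  by rewrite -mulr_suml (H k _).2 ?mul1r// leqnn addnS ltnS leq_addr.
by rewrite IH// => t /andP[kt tl]; apply: H; rewrite (ltnW kt) addnS -addSn.
Qed.

Lemma propagate_ge0 f x : (forall y, 0 <= f y) -> 0 <= propagate Q m L f x.
Proof.
move=> f0; elim: L m x Qstoch => [|l IH] k x H //=.
apply: sumr_ge0 => y _; apply: mulr_ge0.
  by apply: (H k _).1; rewrite leqnn addnS ltnS leq_addr.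
by apply: IH => t /andP[kt tl]; apply: H; rewrite (ltnW kt) addnS -addSn.
Qed.

Lemma le_propagate f g x : (forall y, f y <= g y) ->
  propagate Q m L f x <= propagate Q m L g x.
Proof.
move=> fg; rewrite -subr_ge0.
have -> : propagate Q m L g x - propagate Q m L f x =
    propagate Q m L (fun y => -1 * f y + g y) x by rewrite propagateZD; ring.
by apply: propagate_ge0 => y; have := fg y; lra.
Qed.

End Window.

(** An enclosing interval of length [D] avoids maxima and minima, and any two averages of [f] can be
    compared inside it. *)
Definition osc_le f (D : R) : Prop := exists a, forall x, a <= f x <= a + D.

Lemma osc_le_propagate Q m L f D :
  (forall t, (m <= t < m + L)%N -> stochastic (Q t)) ->
  osc_le f D -> osc_le (propagate Q m L f) D.
Proof.
move=> H [a aP]; exists a => x; apply/andP; split.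
  rewrite -[leLHS](propagate_cst H a x).
  by apply: le_propagate => // y; case/andP: (aP y).
rewrite -[leRHS](propagate_cst H (a + D) x).
by apply: le_propagate => // y; case/andP: (aP y).
Qed.

(** Doeblin's argument: the minorization at [y0] is applied to the nonnegative functions [f - a] and
    [a + D - f], which moves the two ends of the interval inwards by [eps * D] in total. *)
Lemma osc_le_minorized Q m L f D (y0 : T) (eps : R) :
  (forall t, (m <= t < m + L)%N -> stochastic (Q t)) ->
  (forall g x, (forall y, 0 <= g y) -> eps * g y0 <= propagate Q m L g x) ->
  osc_le f D -> osc_le (propagate Q m L f) ((1 - eps) * D).
Proof.
move=> H Heps [a aP]; exists (a + eps * (f y0 - a)) => x.
have lo := Heps (fun y => 1 * f y + (- a)) x _.
have hi := Heps (fun y => -1 * f y + (a + D)) x _.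
rewrite !propagateZD !(propagate_cst H) in lo hi.
have {}lo : eps * (1 * f y0 - a) <= 1 * propagate Q m L f x - a.
  by apply: lo => y; have := aP y; lra.
have {}hi : eps * (-1 * f y0 + (a + D)) <= -1 * propagate Q m L f x + (a + D).
  by apply: hi => y; have := aP y; lra.
by apply/andP; split; lra.
Qed.

(** Only the trajectory along [p] is kept; each of its steps contributes a factor [alpha], and the
    discarded terms are nonnegative. *)
Lemma propagate_path_ge Q m (e : rel T) (alpha : R) f x p :
  0 <= alpha -> (forall y, 0 <= f y) ->
  (forall t, (m <= t < m + size p)%N -> stochastic (Q t)) ->
  (forall t, (m <= t < m + size p)%N ->
     forall x y, Defs.adjacent e x y -> alpha <= Q t x y) ->
  path (Defs.adjacent e) x p ->
  alpha ^+ size p * f (last x p) <= propagate Q m (size p) f x.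
Proof.
move=> a0 f0; elim: p m x => [|z p IH] m x /= Qs Qa; first by rewrite mul1r.
case/andP=> xz zp; rewrite (bigD1 z) //= exprS -mulrA.
have Hm : (m <= m < m + (size p).+1)%N by rewrite leqnn addnS ltnS leq_addr.
have Hs t : (m.+1 <= t < m.+1 + size p)%N -> (m <= t < m + (size p).+1)%N.
  by case/andP=> mt tp; rewrite (ltnW mt) addnS -addSn.
have Qs' t : (m.+1 <= t < m.+1 + size p)%N -> stochastic (Q t).
  by move=> /Hs; exact: Qs.
rewrite -[leLHS]addr0; apply: lerD; last first.
  apply: sumr_ge0 => y _; apply: mulr_ge0; first exact: (Qs m Hm).1.
  exact: propagate_ge0.
apply: ler_pM => //; first by rewrite mulr_ge0// exprn_ge0.
  exact: Qa.
by apply: IH => // t /Hs; exact: Qa.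
Qed.

Lemma path_nseq (e : rel T) x l p :
  reflexive e -> path e x (nseq l x ++ p) = path e x p.
Proof. by move=> e_refl; elim: l => //= l ->; rewrite e_refl. Qed.

(** A path without repetition has fewer than [#|T|] steps; loops at [x], allowed by [adjacent], pad
    it, so that all pairs of vertices get paths of one common length, as Doeblin's argument
    requires. *)
Lemma connected_path (e : rel T) x y : connected_graph e ->
  exists p, [/\ path (Defs.adjacent e) x p, last x p = y & size p = #|T|].
Proof.
move=> /(_ x y) /connectP[p /shortenP[q qe uq _] yE].
have sq : (size q <= #|T|)%N.
  apply: leq_trans (leqnSn _) _; rewrite -[(size q).+1]/(size (x :: q)).
  by rewrite -(card_uniqP uq) max_card.
exists (nseq (#|T| - size q) x ++ q); split.
- rewrite path_nseq => [|z]; last by rewrite /Defs.adjacent eqxx.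
  by apply: sub_path qe => a b ab; rewrite /Defs.adjacent ab orbT.
- by rewrite last_cat yE; congr last; elim: (_ - _)%N => //= n ->.
- by rewrite size_cat size_nseq subnK.
Qed.

(** The steps are cut into [L %/ #|T|] windows of length [#|T|]; in each, every state reaches a
    fixed [y0] with weight at least [alpha ^+ #|T|]. The remaining steps do not increase the
    oscillation. *)
Lemma osc_le_connected Q m L (e : rel T) (alpha : R) f D :
  connected_graph e -> 0 <= alpha ->
  (forall t, (m <= t < m + L)%N -> stochastic (Q t)) ->
  (forall t, (m <= t < m + L)%N ->
     forall x y, Defs.adjacent e x y -> alpha <= Q t x y) ->
  osc_le f D ->
  osc_le (propagate Q m L f) ((1 - alpha ^+ #|T|) ^+ (L %/ #|T|) * D).
Proof.
move=> econn a0 Qs Qa fD.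
have [T0|T_gt0] := posnP #|T|.
  by exists 0 => x; have := fintype0 x T0.
have [y0 _] := card_gt0P T_gt0.
have eqL := divn_eq L #|T|.
move: (L %/ #|T|)%N (L %% #|T|)%N eqL => n l {L}->in Qs Qa *.
elim: n m Qs Qa => [|n IH] m Qs Qa; first by rewrite mul1r; exact: osc_le_propagate.
have in1 t : (m <= t < m + #|T|)%N -> (m <= t < m + (n.+1 * #|T| + l))%N.
  by case/andP=> -> tl; rewrite (leq_trans tl)// mulSn -addnA addnA leq_addr.
have in2 t : (m + #|T| <= t < m + #|T| + (n * #|T| + l))%N ->
    (m <= t < m + (n.+1 * #|T| + l))%N.
  by rewrite mulSn -!addnA => /andP[mt ->]; rewrite (leq_trans (leq_addr _ _) mt).
have [| | |a aP] := @osc_le_minorized Q m #|T|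
    (propagate Q (m + #|T|) (n * #|T| + l) f)
    ((1 - alpha ^+ #|T|) ^+ n * D) y0 (alpha ^+ #|T|).
- by move=> t /in1; exact: Qs.
- move=> g x g0; have [p [xp <- sp]] := connected_path x y0 econn.
  rewrite -sp; apply: (@propagate_path_ge _ _ e) => //; rewrite sp => t /in1.
  - exact: Qs.
  - exact: Qa.
- by apply: IH => t /in2; [exact: Qs|exact: Qa].
by exists a => x; rewrite mulSn -addnA propagateD exprS -mulrA.
Qed.

Lemma stationary_propagate Q m L f (pi : T -> R) :
  (forall t, (m <= t < m + L)%N -> forall y, \sum_x pi x * Q t x y = pi y) ->
  \sum_x pi x * propagate Q m L f x = \sum_x pi x * f x.
Proof.
elim: L m => [|L IH] m H //=.
rewrite -(IH m.+1) => [|t /andP[mt tL]]; last by apply: H; rewrite (ltnW mt) addnS -addSn.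
under eq_bigr do rewrite mulr_sumr; rewrite exchange_big /=.
apply: eq_bigr => y _; rewrite -(H m _ y) ?mulr_suml; last first.
  by rewrite leqnn addnS ltnS leq_addr.
by apply: eq_bigr => x _; rewrite mulrA.
Qed.

Lemma osc_le_average f D (p q : T -> R) :
  osc_le f D -> is_distribution p -> is_distribution q ->
  `|\sum_x p x * f x - \sum_x q x * f x| <= D.
Proof.
move=> [a aP].
suff H (u : T -> R) : is_distribution u -> a <= \sum_x u x * f x <= a + D.
  by move=> /H pP /H qP; rewrite ler_norml; lra.
case=> u0 u1; apply/andP; split.
  rewrite -[leLHS]mul1r -u1 mulr_suml; apply: ler_sum => x _.
  by rewrite ler_wpM2l//; case/andP: (aP x).
rewrite -[leRHS]mul1r -u1 mulr_suml; apply: ler_sum => x _.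
by rewrite ler_wpM2l//; case/andP: (aP x).
Qed.

End Propagation.

(** * The perturbed reversible chain *)

Section PerturbedChain.
Variables (R : realType) (T : finType) (nu : T -> R) (e : rel T).
Variable lab : T -> 'I_#|T|.
Hypotheses (nu_dist : is_distribution nu) (e_simple : simple_graph e).
Hypothesis e_conn : connected_graph e.
Hypothesis nu_disconn : ~ connected_graph (induced_subgraph e (dsupport nu)).
Hypothesis lab_inj : injective lab.

Lemma distribution_le1 (pi : T -> R) x : is_distribution pi -> pi x <= 1.
Proof.
by case=> p0 <-; rewrite (bigD1 x)//= lerDl; apply: sumr_ge0.
Qed.

(** If [nu x] reached 1, the support would be [x] alone, and a one-vertex graph is connected. *)
Lemma disconnected_support_lt1 x : nu x < 1.
Proof.
rewrite ltNge; apply/negP => nux; apply: nu_disconn.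
have nu0 y : y != x -> nu y <= 0.
  move=> yx; have := nu_dist.2; rewrite (bigD1 x)//= (bigD1 y)//=.
  have : 0 <= \sum_(i | (i != x) && (i != y)) nu i.
    by apply: sumr_ge0 => i _; exact: nu_dist.1.
  by move: (\sum_(i | _) nu i) => S; lra.
suff H (u : {z | z \in dsupport nu}) : val u = x.
  by move=> u v; rewrite (_ : u = v) ?connect0//; apply: val_inj; rewrite !H.
apply/eqP; apply: contraT => /nu0; rewrite leNgt.
by have := valP u; rewrite inE => ->.
Qed.

Lemma connected_support : (forall x, 0 < nu x) ->
  connected_graph (induced_subgraph e (dsupport nu)).
Proof.
move=> nu_gt0 u v; have [p] := connectP (e_conn (val u) (val v)).
have supp x : x \in dsupport nu by rewrite inE.
elim: p u => [|z p IH] u /= => [_ vu|/andP[uz zp] vE].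
  by rewrite (_ : u = v) ?connect0//; apply: val_inj.
apply: (@connect_trans _ _ (exist _ z (supp z))); last exact: IH.
exact: connect1.
Qed.

Lemma card_disconnected_gt0 : (0 < #|T|)%N.
Proof.
rewrite lt0n; apply/negP => /eqP T0; apply: nu_disconn => u.
by have := fintype0 (val u) T0.
Qed.

Let nR_gt0 : 0 < #|T|%:R :> R. Proof. by rewrite ltr0n card_disconnected_gt0. Qed.

Section Level.
Variable k : nat.
Hypothesis k_gt0 : (0 < k)%N.

Let kR_gt0 : 0 < k%:R :> R. Proof. by rewrite ltr0n. Qed.
Let kR_ge1 : 1 <= k%:R :> R. Proof. by rewrite ler1n. Qed.

Let kn_ge1 : 1 <= 2 * k%:R * #|T|%:R :> R.
Proof.
have := mulr_ege1 kR_ge1 (_ : 1 <= #|T|%:R :> R).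
by rewrite ler1n card_disconnected_gt0 -mulrA => /(_ isT); lra.
Qed.

(** If the set were empty, [nu] would be at least [1/k] everywhere, and a full support induces the
    connected graph itself. *)
Lemma card_low_set_gt0 : (0 < #|low_set nu k|)%N.
Proof.
rewrite card_gt0; apply/negP => /eqP low0; apply: nu_disconn.
apply: connected_support => x; apply: lt_le_trans (_ : k%:R^-1 <= _).
  by rewrite invr_gt0.
have : x \notin low_set nu k by rewrite low0 inE.
by rewrite inE -leNgt.
Qed.

Lemma low_uniform_distribution : is_distribution (low_uniform nu k).
Proof.
split=> [x|]; first by rewrite divr_ge0.
rewrite -mulr_suml -natr_sum.
have -> : (\sum_x (x \in low_set nu k) = #|low_set nu k|)%N.
  by rewrite -sum1_card [RHS]big_mkcond; apply: eq_bigr => x _; case: ifP.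
by rewrite divff// pnatr_eq0 -lt0n card_low_set_gt0.
Qed.

Let rho := perturbed nu k.

Lemma perturbed_distribution : is_distribution rho.
Proof.
have [eta0 eta1] := low_uniform_distribution; have [nu0 nu1] := nu_dist.
split=> [x|].
  rewrite addr_ge0// mulr_ge0// ?invr_ge0 ?ler0n// divr_ge0 ?ler0n//.
  by rewrite subr_ge0.
by rewrite big_split/= -!mulr_sumr eta1 nu1; field; rewrite gt_eqF.
Qed.

(** On [low_set] the uniform part alone gives [1/(k |T|)]. Off it, [nu x >= 1/k] and the factor
    [(k - 1)/k] is at least 1/2, because [k = 1] would force [nu x >= 1]. *)
Lemma perturbed_ge x : (2 * k%:R * #|T|%:R)^-1 <= rho x.
Proof.
have T_gt0 := card_disconnected_gt0.
have n1 : 1 <= #|T|%:R :> R by rewrite ler1n.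
have ki : 0 < k%:R^-1 :> R by rewrite invr_gt0.
have kk : k%:R * k%:R^-1 = 1 :> R by rewrite divff// gt_eqF.
have le2 : (2 * k%:R * #|T|%:R)^-1 <= k%:R^-1 / 2 :> R.
  rewrite -invfM lef_pV2 ?posrE.
  - by nra.
  - by rewrite ?mulr_gt0 ?exprn_gt0 ?mulr_gt0.
  - by rewrite ?mulr_gt0 ?exprn_gt0 ?mulr_gt0.
have nu0 := nu_dist.1 x.
rewrite /rho /perturbed /low_uniform; case: (boolP (x \in low_set nu k)) => xlow.
  apply: le_trans (_ : k%:R^-1 * (1 / #|low_set nu k|%:R) <= _); last first.
    by rewrite lerDl mulr_ge0// divr_ge0 ?ler0n// subr_ge0.
  have low_gt0 : 0 < #|low_set nu k|%:R :> R by rewrite ltr0n card_low_set_gt0.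
  have lowT : #|low_set nu k|%:R <= #|T|%:R :> R by rewrite ler_nat max_card.
  rewrite mul1r -invfM lef_pV2 ?posrE.
  - by nra.
  - by rewrite ?mulr_gt0 ?exprn_gt0 ?mulr_gt0.
  - by rewrite ?mulr_gt0 ?exprn_gt0 ?mulr_gt0.
move: xlow; rewrite inE -leNgt mul0r mulr0 add0r => xlow.
apply: le_trans le2 _.
have k2 : 2 <= k%:R :> R.
  rewrite (ler_nat _ 2) ltnNge; apply/negP => k1.
  have /eqP kE : k == 1%N by rewrite eqn_leq k1.
  by have := disconnected_support_lt1 x; move: xlow; rewrite kE invr1; lra.
have h : 2^-1 <= (k%:R - 1) / k%:R :> R by rewrite ler_pdivlMr//; lra.
rewrite mulrC; apply: ler_pM => //; lra.
Qed.

Lemma perturbed_gt0 x : 0 < rho x.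
Proof.
apply: lt_le_trans (perturbed_ge x).
by rewrite invr_gt0 !mulr_gt0// ltr0n card_disconnected_gt0.
Qed.

(** [rho - nu] is [1/k] times the difference of the distributions [low_uniform nu k] and [nu], whose
    l1 norm is at most 2. *)
Lemma perturbed_close : \sum_x `|rho x - nu x| <= 2 / k%:R.
Proof.
have [eta0 eta1] := low_uniform_distribution; have [nu0 nu1] := nu_dist.
apply: le_trans (_ : \sum_x k%:R^-1 * (low_uniform nu k x + nu x) <= _).
  apply: ler_sum => x _.
  rewrite (_ : rho x - nu x = k%:R^-1 * (low_uniform nu k x - nu x)).
    rewrite normrM gtr0_norm ?invr_gt0// ler_wpM2l ?invr_ge0 ?ler0n//.
    by have := nu0 x; have := eta0 x; rewrite ler_norml; lra.
  by rewrite /rho /perturbed; field; rewrite gt_eqF.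
by rewrite -mulr_sumr big_split/= eta1 nu1; lra.
Qed.

(** One formula for both orders of the labels: off-diagonal entries of the matrix are [base_rate]
    times this weight, and [label_degree] is a sum of weights. *)
Let weight x y : R :=
  (if (lab x < lab y)%N then 1 else rho y / rho x) * (e x y)%:R.

Let weight_ge0 x y : 0 <= weight x y.
Proof.
rewrite /weight; case: ifP => _; rewrite mulr_ge0// divr_ge0 ?ltW//;
  exact: perturbed_gt0.
Qed.

Let label_degreeE x : label_degree lab e rho x = \sum_(y | y != x) weight x y.
Proof.
rewrite (bigID (fun y => (lab x < lab y)%N))/= /label_degree; congr (_ + _).
  apply: eq_big => y => [|xy]; last by rewrite /weight xy mul1r.
  by case: eqP => [->|]; rewrite ?ltnn.
apply: eq_big => y => [|xy]; last by rewrite /weight ltnNge (ltnW xy).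
rewrite -leqNgt ltn_neqAle; congr (~~ _ && _).
by apply/eqP/eqP => [/val_inj/lab_inj|->].
Qed.

Let D := label_degree lab e rho.

(** With a single vertex the induced subgraph would be connected; so there is a second vertex, and
    connectedness gives [x] a neighbour. *)
Lemma label_degree_gt0 x : 0 < D x.
Proof.
have [y yx] : exists y, y != x.
  apply: contrapT => /forallNP H; apply: nu_disconn => u v.
  rewrite (_ : u = v) ?connect0//; apply: val_inj.
  by have /negP/negPn/eqP -> := H (val u); have /negP/negPn/eqP -> := H (val v).
have [z xz] : exists z, e x z.
  have /connectP[[|z p]/=] := e_conn x y; first by move=> _ yE; rewrite yE eqxx in yx.
  by case/andP=> xz _ _; exists z.
have zx : z != x by apply: contraTneq xz => ->; rewrite e_simple.2.
rewrite /D label_degreeE (bigD1 z)//= ltr_wpDr//; first exact: sumr_ge0.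
rewrite /weight xz mulr1; case: ifP => // _.
by rewrite divr_gt0// perturbed_gt0.
Qed.

(** Each weight is at most [2 * k * #|T|], because [rho y <= 1] and [rho x] is bounded below by
    [perturbed_ge]. *)
Lemma label_degree_le x : D x <= 2 * k%:R * #|T|%:R ^+ 2.
Proof.
have n1 : 1 <= #|T|%:R :> R by rewrite ler1n card_disconnected_gt0.
have kn := kn_ge1.
have weight_le y : weight x y <= 2 * k%:R * #|T|%:R.
  rewrite /weight; have : (e x y)%:R <= 1 :> R by rewrite lern1 leq_b1.
  have : 0 <= (e x y)%:R :> R by rewrite ler0n.
  suff : (if (lab x < lab y)%N then 1 else rho y / rho x) <= 2 * k%:R * #|T|%:R.
    have : 0 <= (if (lab x < lab y)%N then 1 else rho y / rho x).
      by case: ifP => // _; rewrite divr_ge0 ?ltW//; exact: perturbed_gt0.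
    by move: (if _ then _ else _) => w; nra.
  case: ifP => // _; rewrite ler_pdivrMr ?perturbed_gt0//.
  apply: le_trans (distribution_le1 y perturbed_distribution) _.
  rewrite mulrC -ler_pdivrMr; first by rewrite mul1r perturbed_ge.
  by apply: lt_le_trans kn.
rewrite /D label_degreeE; apply: le_trans (_ : \sum_y 2 * k%:R * #|T|%:R <= _).
  rewrite [leRHS](bigID (fun y => y != x))/=.
  by rewrite -[leLHS]addr0 lerD ?ler_sum// sumr_ge0// => *; lra.
by rewrite sumr_const -mulr_natr; lra.
Qed.

Let p := base_rate lab e rho.

Lemma base_rate_le x : p <= (2 * D x)^-1.
Proof.
apply: ge_inf; last by exists x.
exists 0 => _ [y _ <-]; rewrite invr_ge0 mulr_ge0// ltW//; exact: label_degree_gt0.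
Qed.

Lemma base_rate_ge : (4 * k%:R * #|T|%:R ^+ 2)^-1 <= p.
Proof.
apply: lb_le_inf.
  by have [x _] := card_gt0P card_disconnected_gt0; exists (2 * D x)^-1; exists x.
have n1 : 1 <= #|T|%:R ^+ 2 :> R by rewrite exprn_ege1// ler1n card_disconnected_gt0.
move=> _ [y _ <-]; have Dy := label_degree_le y; have D0 := label_degree_gt0 y.
rewrite -/D lef_pV2 ?posrE.
- by lra.
- by rewrite ?mulr_gt0 ?exprn_gt0 ?mulr_gt0.
- by rewrite ?mulr_gt0 ?exprn_gt0 ?mulr_gt0.
Qed.

Let base_rate_gt0 : 0 < p.
Proof.
apply: lt_le_trans base_rate_ge.
by rewrite invr_gt0 !mulr_gt0// exprn_gt0// ltr0n card_disconnected_gt0.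
Qed.

(** The factor 2 in [base_rate] makes the chain lazy: at least one half remains on the diagonal. *)
Let base_rate_degree_le x : p * D x <= 2^-1.
Proof.
have := base_rate_le x; have := label_degree_gt0 x; rewrite -/D.
by move=> D0; rewrite invfM -ler_pdivlMr// mulrC.
Qed.

Let A := reversible_matrix lab e rho.

Let off_diagonal x y : y != x -> A x y = p * weight x y.
Proof.
move=> yx; rewrite /A /reversible_matrix eq_sym (negPf yx) /weight -/p.
by case: (e x y); case: ifP => _; rewrite ?mulr1 ?mulr0// mulrC.
Qed.

Lemma reversible_matrix_stochastic : stochastic A.
Proof.
split=> [x y|x].
  have [->|yx] := eqVneq y x; last by rewrite off_diagonal// mulr_ge0// ltW.
  by rewrite /A /reversible_matrix eqxx -/p -/(D x); have := base_rate_degree_le x; lra.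
rewrite (bigD1 x)//= (eq_bigr _ (off_diagonal (x:=x))) -mulr_sumr -label_degreeE.
by rewrite /A /reversible_matrix eqxx subrK.
Qed.

(** Detailed balance [rho x * A x y = rho y * A y x] turns the column sum into a row sum. *)
Lemma reversible_matrix_stationary y : \sum_x rho x * A x y = rho y.
Proof.
rewrite -[RHS]mulr1 -(reversible_matrix_stochastic.2 y) mulr_sumr.
apply: eq_bigr => x _; have [->//|xy] := eqVneq x y.
rewrite !off_diagonal//; last by rewrite eq_sym.
have := perturbed_gt0 x; have := perturbed_gt0 y => ry rx.
rewrite /weight (e_simple.1 y x); case: ltngtP => [_|_|/val_inj/lab_inj].
- by field; rewrite gt_eqF.
- by field; rewrite gt_eqF.
- by move=> E; rewrite E eqxx in xy.
Qed.

(** Along an edge the weight is at least [(2 k |T|)^-1] and [base_rate] at least [(4 k |T|^2)^-1];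
    the constant is the product of the two. The diagonal is at least 1/2. *)
Lemma reversible_matrix_ge x y : Defs.adjacent e x y ->
  (8 * #|T|%:R ^+ 3 * k%:R ^+ 2)^-1 <= A x y.
Proof.
have n1 : 1 <= #|T|%:R :> R by rewrite ler1n card_disconnected_gt0.
have rx := perturbed_gt0 x.
have le1 : (2 * k%:R * #|T|%:R)^-1 <= 1 :> R.
  by rewrite invf_le1//; apply: lt_le_trans kn_ge1.
have i0 : 0 <= (2 * k%:R * #|T|%:R)^-1 :> R by rewrite invr_ge0 (le_trans _ kn_ge1).
have E : (8 * #|T|%:R ^+ 3 * k%:R ^+ 2)^-1 =
    (2 * k%:R * #|T|%:R)^-1 * (4 * k%:R * #|T|%:R ^+ 2)^-1 :> R.
  by rewrite -invfM; congr (_^-1); ring.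
have j0 : 0 <= (4 * k%:R * #|T|%:R ^+ 2)^-1 :> R.
  by rewrite invr_ge0 mulr_ge0// exprn_ge0//; lra.
have j1 : (4 * k%:R * #|T|%:R ^+ 2)^-1 <= 2^-1 :> R.
  have n2 : 1 <= #|T|%:R ^+ 2 :> R by rewrite exprn_ege1.
  rewrite lef_pV2 ?posrE.
  - by have := mulr_ege1 kR_ge1 n2; lra.
  - by rewrite ?mulr_gt0 ?exprn_gt0 ?mulr_gt0.
  - by rewrite ?mulr_gt0 ?exprn_gt0 ?mulr_gt0.
have [->|yx] := eqVneq y x.
  rewrite /A /reversible_matrix eqxx -/p -/(D x) => _.
  by have := base_rate_degree_le x; rewrite E; nra.
rewrite /Defs.adjacent eq_sym (negPf yx)/= => exy.
rewrite off_diagonal// /weight exy mulr1 E [leRHS]mulrC.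
apply: ler_pM => //; last exact: base_rate_ge.
case: ifP => // _; rewrite ler_pdivlMr//.
have := distribution_le1 x perturbed_distribution.
by have := perturbed_ge y; rewrite -/rho; nra.
Qed.

End Level.

End PerturbedChain.

(** * Piecewise constant transition matrices *)

(** A division-free form of [(1 - eps)^n <= 1/(1 + n eps)]; it turns a long interval into an
    [O(1/k)] bound without exponentials. *)
Lemma bernoulli_expr (R : realType) (eps : R) n :
  0 <= eps <= 1 -> (1 - eps) ^+ n * (1 + n%:R * eps) <= 1.
Proof.
case/andP=> e0 e1; elim: n => [|n IH]; first by rewrite expr0 mul0r addr0 mulr1.
apply: le_trans IH; rewrite exprSr -mulrA ler_wpM2l ?exprn_ge0 ?subr_ge0//.
by rewrite -natr1; have : 0 <= n%:R :> R by []; move: n%:R => x; nra.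
Qed.

(** Each power of [1 - eps] is repeated [n] times, so the sum is at most [n] times a geometric
    series. *)
Lemma sum_expr_divn_le (R : realType) (eps : R) n t : (0 < n)%N ->
  0 < eps <= 1 -> \sum_(0 <= L < t) (1 - eps) ^+ (L %/ n) <= n%:R / eps.
Proof.
move=> n0 /andP[e0 e1]; have r0 : 0 <= 1 - eps by rewrite subr_ge0.
(* Extended to whole groups of [n] equal terms, the sum has a closed form. *)
apply: le_trans (_ : \sum_(0 <= L < t * n) (1 - eps) ^+ (L %/ n) <= _).
  rewrite [leRHS](@big_cat_nat _ _ _ t)//=; last by rewrite leq_pmulr.
  by rewrite lerDl sumr_ge0// => i _; rewrite exprn_ge0.
rewrite ler_pdivlMr//; suff -> : (\sum_(0 <= L < t * n) (1 - eps) ^+ (L %/ n)) * eps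
    = n%:R * (1 - (1 - eps) ^+ t).
  by rewrite ler_piMr// gerBl exprn_ge0.
elim: t => [|t IH]; first by rewrite mul0n big_geq// expr0 subrr mul0r mulr0.
rewrite (@big_cat_nat _ _ _ (t * n))//=; last by rewrite leq_mul.
rewrite mulrDl IH (@eq_big_nat _ _ _ (t * n) _ _ (fun=> (1 - eps) ^+ t)); last first.
  move=> i; rewrite mulSn addnC => /andP[ti it]; congr (_ ^+ _).
  apply/eqP; rewrite eqn_leq -ltnS ltn_divLR// mulSn addnC it/=.
  by rewrite leq_divRL.
by rewrite big_const_nat iter_addr_0 mulSn addnK -mulr_natr exprS; ring.
Qed.

Section Blocks.
Variable tau : nat -> nat.
Hypothesis tau_incr : forall l, (0 < l)%N -> (tau l < tau l.+1)%N.

Lemma blocks_le k l : (0 < k)%N -> (k <= l)%N -> (tau k <= tau l)%N.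
Proof.
move=> k0; elim: l => [|l IH]; first by rewrite leqNgt k0.
rewrite leq_eqVlt => /orP[/eqP->//|kl].
by apply: leq_trans (IH kl) _; rewrite ltnW// tau_incr// (leq_trans k0).
Qed.

Lemma blocks_ge k : (k <= tau k.+1)%N.
Proof. by elim: k => // k IH; apply: leq_ltn_trans IH _; exact: tau_incr. Qed.

Lemma block_index t : (tau 1 <= t)%N ->
  exists2 k, (0 < k)%N & (tau k <= t < tau k.+1)%N.
Proof.
(* The index is the largest [k] with [tau k <= t]; it exists since [tau k.+1 >= k]. *)
move=> t1; pose B k := (0 < k)%N && (tau k <= t)%N.
have exB : exists k, B k by exists 1%N.
have ubB k : B k -> (k <= t.+1)%N.
  by case: k => // k /andP[_]; apply: leq_trans; exact: blocks_ge.
case: (ex_maxnP exB ubB) => k /andP[k0 kt] kmax; exists k; rewrite // kt ltnNge.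
by apply/negP => kt'; have := kmax k.+1; rewrite /B kt' ltnn => /(_ isT).
Qed.

Lemma block_index_le k l t : (0 < k)%N -> (0 < l)%N ->
  (tau k <= t)%N -> (t < tau l.+1)%N -> (k <= l)%N.
Proof.
move=> k0 l0 kt tl; rewrite leqNgt; apply/negP => lk.
by have := blocks_le (ltn0Sn l) lk; rewrite leqNgt (leq_ltn_trans kt).
Qed.

(** The intervals are disjoint, so at most one term of the series is nonzero and its partial sums
    are eventually constant. *)
Lemma switching_matrixE (R : realType) (T : finType) (nu : T -> R) lab e k t x y :
  (0 < k)%N -> (tau k <= t < tau k.+1)%N ->
  switching_matrix nu lab e tau t x y = reversible_matrix lab e (perturbed nu k) x y.
Proof.
move=> k0 kt; apply: lim_near_cst => //; exists k.+1 => // n /= kn.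
rewrite (bigD1_seq k) ?mem_index_iota ?iota_uniq ?k0//= kt mulr1.
rewrite big1_seq ?addr0// => l /andP[lk]; rewrite mem_index_iota => /andP[l0 _].
case: (boolP (tau l <= t < tau l.+1)%N) => [|_]; last by rewrite mulr0.
case/andP=> lt tl; case/andP: kt => kt tk; case/eqP: lk.
by apply/eqP; rewrite eqn_leq; apply/andP; split; apply: block_index_le; eassumption.
Qed.

End Blocks.

(** * The switching chain: convergence of its law and bounds on its covariances *)

Section SwitchingChain.
Variables (R : realType) (T : finType) (nu : T -> R) (e : rel T).
Variables (lab : T -> 'I_#|T|) (tau : nat -> nat) (c : R) (q : nat).
Hypotheses (nu_dist : is_distribution nu) (e_simple : simple_graph e).
Hypothesis e_conn : connected_graph e.
Hypothesis nu_disconn : ~ connected_graph (induced_subgraph e (dsupport nu)).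
Hypothesis lab_inj : injective lab.
Hypothesis tau_incr : forall l, (0 < l)%N -> (tau l < tau l.+1)%N.
Hypothesis tau1 : tau 1 = 0%N.
Hypothesis c_gt0 : 0 < c.
Hypothesis tau_gap : forall l, (0 < l)%N ->
  c * l%:R ^+ q <= (tau l.+1)%:R - (tau l)%:R.

Let Q := switching_matrix nu lab e tau.
Let n := #|T|.
Let n_gt0 : (0 < n)%N := card_disconnected_gt0 nu_disconn.
Let alpha k : R := (8 * n%:R ^+ 3 * k%:R ^+ 2)^-1.

Lemma switching_matrix_stochastic t : stochastic (Q t).
Proof.
have [|k k0 kt] := @block_index _ tau_incr t; first by rewrite tau1.
have [A0 A1] := reversible_matrix_stochastic nu_dist e_simple e_conn
  nu_disconn lab_inj k0.
split=> [x y|x]; first by rewrite /Q (switching_matrixE tau_incr _ _ _ _ _ k0 kt).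
by under eq_bigr do rewrite /Q (switching_matrixE tau_incr _ _ _ _ _ k0 kt).
Qed.

Let denom_gt0 k : (0 < k)%N -> 0 < 8 * n%:R ^+ 3 * k%:R ^+ 2 :> R.
Proof. by move=> k0; rewrite !mulr_gt0 ?exprn_gt0 ?ltr0n. Qed.

(** [alpha] decreases with the index, so the bound of interval [k] also serves at all earlier
    times. *)
Lemma switching_matrix_ge k t : (0 < k)%N -> (t < tau k.+1)%N ->
  forall x y, Defs.adjacent e x y -> alpha k <= Q t x y.
Proof.
move=> k0 tk x y xy.
have [|l l0 lt] := @block_index _ tau_incr t; first by rewrite tau1.
rewrite /Q (switching_matrixE tau_incr _ _ _ _ _ l0 lt).
apply: le_trans (reversible_matrix_ge nu_dist e_simple e_conn
  nu_disconn lab_inj l0 xy).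
have lk : (l <= k)%N.
  by case/andP: lt => lt _; apply: block_index_le tk.
rewrite /alpha lef_pV2 ?posrE ?denom_gt0// ler_wpM2l//.
by rewrite lerXn2r ?nnegrE ?ler_nat.
Qed.

Lemma switching_matrix_stationary k t : (0 < k)%N -> (tau k <= t < tau k.+1)%N ->
  forall y, \sum_x perturbed nu k x * Q t x y = perturbed nu k y.
Proof.
move=> k0 kt y.
rewrite -[RHS](reversible_matrix_stationary nu_dist e_simple e_conn
  nu_disconn lab_inj k0).
by apply: eq_bigr => x _; rewrite /Q (switching_matrixE tau_incr _ _ _ _ _ k0 kt).
Qed.

Lemma osc_le_switching k m L f D : (0 < k)%N -> (m + L <= tau k.+1)%N ->
  osc_le f D ->
  osc_le (propagate Q m L f) ((1 - alpha k ^+ n) ^+ (L %/ n) * D).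
Proof.
move=> k0 mL; apply: (osc_le_connected e_conn).
- by rewrite invr_ge0 ltW// denom_gt0.
- by move=> t _; exact: switching_matrix_stochastic.
- by move=> t /andP[_ tmL]; apply: switching_matrix_ge => //; exact: leq_trans mL.
Qed.

Let alpha_gt0 k : (0 < k)%N -> 0 < alpha k.
Proof. by move=> k0; rewrite invr_gt0 denom_gt0. Qed.

Let alphan_itv k : (0 < k)%N -> 0 < alpha k ^+ n <= 1.
Proof.
move=> k0; rewrite exprn_gt0 ?alpha_gt0//= exprn_ile1 ?(ltW (alpha_gt0 k0))//.
rewrite /alpha invf_le1 ?denom_gt0// -!mulrA.
have n1 : 1 <= n%:R ^+ 3 :> R by rewrite exprn_ege1// ler1n.
have k1 : 1 <= k%:R ^+ 2 :> R by rewrite exprn_ege1// ler1n.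
by have := mulr_ege1 n1 k1; lra.
Qed.

Let indicator (s x : T) : R := (x == s)%:R.

Lemma osc_le_indicator s : osc_le (indicator s) 1.
Proof. by exists 0 => x; rewrite add0r ler0n lern1 leq_b1. Qed.

Lemma sum_indicator s (f : T -> R) : \sum_x f x * indicator s x = f s.
Proof.
rewrite (bigD1 s)//= /indicator eqxx mulr1 big1 ?addr0// => x /negPf ->.
by rewrite mulr0.
Qed.

(** [p t] stands for the law of the chain at time [t], kept abstract so that no probability space
    enters here. *)
Variable p : nat -> T -> R.
Hypothesis p_dist : forall t, is_distribution (p t).
Hypothesis p_propagate : forall t L s,
  p (t + L) s = \sum_x p t x * propagate Q t L (indicator s) x.

(** The [k]-th interval holds about [c k^q / n] windows, each contracting by [1 - ep] with [ep] of
    order [k^(-2n)]. As [q > 2n], the number of windows times [ep] is at least of order [k], and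
    [bernoulli_expr] concludes. *)
Lemma block_mixing k : (2 * n < q)%N -> (0 < k)%N ->
  (1 - alpha k ^+ n) ^+ ((tau k.+1 - tau k) %/ n) <=
  n%:R * (8 * n%:R ^+ 3) ^+ n / c / k%:R.
Proof.
move=> nq k0; set L := ((tau k.+1 - tau k) %/ n)%N; set ep := alpha k ^+ n.
have /andP[ep0 ep1] := alphan_itv k0; rewrite -/ep in ep0 ep1.
have k0R : 0 < k%:R :> R by rewrite ltr0n.
have n0R : 0 < n%:R :> R by rewrite ltr0n.
have k1R : 1 <= k%:R :> R by rewrite ler1n.
have A0 : 0 < (8 * n%:R ^+ 3) ^+ n :> R by rewrite exprn_gt0// mulr_gt0// exprn_gt0.
have epE : ep * ((8 * n%:R ^+ 3) ^+ n * k%:R ^+ (2 * n)) = 1.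
  rewrite /ep /alpha exprM -exprMn -exprMn mulVf ?expr1n//.
  by rewrite gt_eqF// denom_gt0.
have LL : c * k%:R ^+ q <= n%:R * (L%:R + 1).
  apply: le_trans (tau_gap k0) _.
  rewrite -natrB; last by rewrite ltnW// tau_incr.
  by rewrite natr1 -natrM ler_nat ltnW// mulnC; apply: ltn_ceil.
have kq : k%:R * k%:R ^+ (2 * n) <= k%:R ^+ q :> R.
  by rewrite -exprS; apply: ler_weXn2l.
have Lep : c * k%:R <= (L%:R + 1) * ep * (n%:R * (8 * n%:R ^+ 3) ^+ n).
  have kn0 : 0 < k%:R ^+ (2 * n) :> R by rewrite exprn_gt0.
  rewrite -(ler_pM2r kn0).
  rewrite (_ : _ * _ * _ * _ = n%:R * (L%:R + 1) *
    (ep * ((8 * n%:R ^+ 3) ^+ n * k%:R ^+ (2 * n)))).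
    rewrite epE mulr1; apply: le_trans LL; rewrite -mulrA ler_wpM2l// ltW//.
  by ring.
have B := @bernoulli_expr _ ep L; rewrite (ltW ep0) ep1 in B.
have {}B := B isT.
have X0 : 0 <= (1 - ep) ^+ L by rewrite exprn_ge0// subr_ge0.
rewrite -mulrA -invfM ler_pdivlMr; last by rewrite mulr_gt0.
apply: le_trans (ler_wpM2l X0 Lep) _.
rewrite [leLHS]mulrA; apply: ler_piMl; first by rewrite mulr_ge0// ltW.
(* [(L + 1) * ep <= 1 + L * ep] because [ep <= 1]. *)
apply: le_trans B; rewrite ler_wpM2l//.
by rewrite mulrDl mul1r addrC lerD2r.
Qed.

(** At the end of interval [k] the law is near [nu_k], whatever it was before. During interval
    [k + 1], possibly too short up to [t] for new mixing, [nu_k] is compared with the stationary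
    [nu_(k+1)]. Of the constant 6, this comparison through [nu] costs 4, and passing from [nu_(k+1)]
    to [nu] costs 2. *)
Lemma law_close k t s : (2 * n < q)%N -> (0 < k)%N ->
  (tau k.+1 <= t < tau k.+2)%N ->
  `|p t s - nu s| <= (n%:R * (8 * n%:R ^+ 3) ^+ n / c + 6) / k%:R.
Proof.
move=> nq k0 /andP[kt tk].
set L1 := (tau k.+1 - tau k)%N; set L2 := (t - tau k.+1)%N.
have kk := ltnW (tau_incr k0).
have eL1 : (tau k + L1 = tau k.+1)%N by rewrite subnKC.
have eL2 : (tau k.+1 + L2 = t)%N by rewrite subnKC.
(* [G'] carries the indicator back from [t] to the start of interval [k + 1], and [G] further back
   over all of interval [k]. *)
pose G' := propagate Q (tau k.+1) L2 (indicator s).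
pose G := propagate Q (tau k) L1 G'.
have pt : p t s = \sum_x p (tau k) x * G x.
  rewrite -eL2 -eL1 -addnA p_propagate; apply: eq_bigr => x _.
  by rewrite propagateD eL1.
have Gosc : osc_le G ((1 - alpha k ^+ n) ^+ (L1 %/ n) * 1).
  apply: osc_le_switching => //; first by rewrite eL1.
  apply: osc_le_propagate (osc_le_indicator s) => ? _.
  exact: switching_matrix_stochastic.
have dist l : (0 < l)%N -> is_distribution (perturbed nu l).
  exact: (perturbed_distribution nu_dist e_conn nu_disconn).
have e1 := osc_le_average Gosc (p_dist (tau k)) (dist k k0).
rewrite mulr1 -pt in e1.
have nuG : \sum_x perturbed nu k x * G x = \sum_x perturbed nu k x * G' x.
  apply: stationary_propagate => u; rewrite eL1; exact: switching_matrix_stationary.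
have nuG' : \sum_x perturbed nu k.+1 x * G' x = perturbed nu k.+1 s.
  rewrite -[RHS]sum_indicator; apply: stationary_propagate => u.
  rewrite eL2 => /andP[ku ut]; apply: switching_matrix_stationary => //.
  by rewrite ku (ltn_trans ut).
have G'1 x : 0 <= G' x <= 1.
  have st u : (tau k.+1 <= u < tau k.+1 + L2)%N -> stochastic (Q u).
    by move=> _; exact: switching_matrix_stochastic.
  rewrite propagate_ge0//= -[leRHS](propagate_cst st 1 x).
  by apply: le_propagate => // y; rewrite lern1 leq_b1.
have close l := perturbed_close nu_dist e_conn nu_disconn (k:=l).
have nus l : (0 < l)%N -> `|perturbed nu l s - nu s| <= 2 / l%:R.
  by move=> /close; apply: le_trans; rewrite (bigD1 s)//= lerDl sumr_ge0.
have k1 : 2 / k.+1%:R <= 2 / k%:R :> R.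
  by rewrite ler_wpM2l// lef_pV2 ?posrE ?ltr0n// ler_nat.
have e2 : `|\sum_x perturbed nu k x * G' x - \sum_x perturbed nu k.+1 x * G' x|
    <= 2 / k%:R + 2 / k%:R.
  rewrite -sumrB; apply: le_trans (ler_norm_sum _ _ _) _.
  apply: le_trans (lerD (close k k0) (le_trans (close k.+1 isT) k1)).
  rewrite -big_split/=; apply: ler_sum => x _; rewrite -mulrBl normrM.
  have [g0 g1] := andP (G'1 x); rewrite (ger0_norm g0).
  apply: le_trans (ler_piMr (normr_ge0 _) g1) _.
  apply: le_trans (ler_distD (nu x) _ _) _; by rewrite [X in _ + X <= _]distrC.
rewrite -nuG nuG' in e2.
have e3 := le_trans (nus k.+1 isT) k1.
have := block_mixing nq k0; rewrite mulrDl -/L1 => mix.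
have -> : p t s - nu s = (p t s - \sum_x perturbed nu k x * G x) +
  (\sum_x perturbed nu k x * G x - perturbed nu k.+1 s) + (perturbed nu k.+1 s - nu s).
  by ring.
apply: le_trans (ler_normD _ _) _; apply: le_trans (lerD (ler_normD _ _) e3) _.
apply: le_trans (lerD (lerD (le_trans e1 mix) e2) (lexx _)) _.
by lra.
Qed.

Lemma law_cvg s : (2 * n < q)%N -> p ^~ s @ \oo --> nu s.
Proof.
move=> nq; apply/cvgrPdist_le => ep ep0.
set C := n%:R * (8 * n%:R ^+ 3) ^+ n / c + 6.
have C0 : 0 <= C.
  by rewrite addr_ge0// divr_ge0 ?(ltW c_gt0)// mulr_ge0// exprn_ge0// mulr_ge0// exprn_ge0.
pose k := (Num.truncn (C / ep)).+1.
have kC : C / ep <= k%:R by rewrite ltW// /k truncnS_gt.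
exists (tau k.+1) => // t /= kt; rewrite distrC.
have [|l l0 /andP[lt tl]] := @block_index _ tau_incr t; first by rewrite tau1.
have kl : (k.+1 <= l)%N by apply: block_index_le tl.
(* [law_close] concerns the interval after its index, hence the shift by one. *)
case: l l0 lt tl kl => // l _ lt tl; rewrite ltnS => kl.
have l0 : (0 < l)%N by apply: leq_trans kl.
apply: (le_trans (law_close s nq l0 _)); first by rewrite lt.
rewrite -/C ler_pdivrMr ?ltr0n// mulrC -ler_pdivrMr//.
by apply: le_trans kC _; rewrite ler_nat.
Qed.

(** The gap before [tau k] gives [c (k - 1)^(4n) <= tau k <= j^4] for [k >= 2]; a square root then
    yields the claim. *)
Lemma block_index_growth : (4 * n <= q)%N ->
  exists2 C : R, 0 <= C & forall j k, (0 < j)%N -> (0 < k)%N ->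
    (tau k <= j ^ 4)%N -> k%:R ^+ (2 * n) <= C * j%:R ^+ 2.
Proof.
(* [c1 ^+ 2 <= c], so the square root can be taken by comparing squares. *)
move=> nq; pose c1 := Num.min c 1.
have c10 : 0 < c1 by rewrite lt_min c_gt0 ltr01.
have c1c : c1 <= c by rewrite ge_min lexx.
have c11 : c1 <= 1 by rewrite ge_min lexx orbT.
exists (2 ^+ (2 * n) / c1); first by rewrite divr_ge0 ?(ltW c10)// exprn_ge0.
move=> j k j0 k0 kj.
(* [l] will be [k - 1], or 1 when [k = 1]; the factor 2 pays for the shift. *)
suff H : exists2 l, (k <= 2 * l)%N & c1 * l%:R ^+ (2 * n) <= j%:R ^+ 2.
  have [l kl lj] := H.
  apply: le_trans (_ : (2 * l%:R) ^+ (2 * n) <= _).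
    by rewrite lerXn2r ?nnegrE ?mulr_ge0// -natrM ler_nat.
  rewrite exprMn -[leRHS]mulrA ler_wpM2l ?exprn_ge0//.
  by rewrite mulrC ler_pdivlMr// mulrC.
case: k k0 kj => // -[_ _|k _ kj].
  by exists 1%N => //; rewrite expr1n mulr1 (le_trans c11)// exprn_ege1// ler1n.
exists k.+1; first by rewrite mul2n -addnn addSn ltnS leq_addl.
rewrite -(@ler_pXn2r _ 2) ?nnegrE ?mulr_ge0 ?exprn_ge0 ?(ltW c10)//.
rewrite exprMn -exprM -exprM mulnAC -[(2 * 2)%N]/4%N.
have gap := tau_gap (ltn0Sn k).
have k1 : 1 <= k.+1%:R :> R by rewrite ler1n.
apply: le_trans (_ : c * k.+1%:R ^+ q <= _).
  apply: ler_pM; rewrite ?exprn_ge0 ?(ltW c10)//.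
    by rewrite expr2; have := c10; nra.
  by apply: ler_weXn2l.
apply: le_trans gap _; apply: le_trans (_ : (tau k.+2)%:R <= _).
  by rewrite lerBlDr lerDl.
by rewrite -natrX ler_nat.
Qed.

(** The covariance at lag [L] is at most the oscillation of the indicator carried back [L] steps.
    With [k] the interval of time [j^4], these sum to at most [n / alpha k ^+ n], of order [k^(2n)],
    which [block_index_growth] bounds by [O(j^2)]. *)
Lemma covariance_sum_le s : (4 * n <= q)%N ->
  exists2 C : R, 0 <= C & forall j m, (m < j ^ 4)%N ->
    \sum_(m <= t < j ^ 4)
      `|p m s * propagate Q m (t - m) (indicator s) s - p m s * p t s|
    <= C * j%:R ^+ 2.
Proof.
move=> nq; have [C C0 HC] := block_index_growth nq.
set A := n%:R * (8 * n%:R ^+ 3) ^+ n : R.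
have A0 : 0 <= A by rewrite mulr_ge0// exprn_ge0// mulr_ge0// exprn_ge0.
exists (A * C) => [|j m mj]; first exact: mulr_ge0.
have j0 : (0 < j)%N by case: j mj => //; rewrite exp0n// ltn0.
have [|k k0 /andP[kj jk]] := @block_index _ tau_incr (j ^ 4); first by rewrite tau1.
have epE : n%:R / alpha k ^+ n = A * k%:R ^+ (2 * n).
  by rewrite /alpha exprVn invrK [in LHS]exprMn -exprM mulrA.
rewrite -mulrA; apply: le_trans (ler_wpM2l A0 (HC j k j0 k0 kj)).
rewrite -epE; apply: le_trans (sum_expr_divn_le (j ^ 4 - m) n_gt0 (alphan_itv k0)).
rewrite -{1}[m]add0n big_addn; apply: ler_sum_nat => L /andP[_ Lj].
rewrite addnK -mulrBr normrM.
have [p0 _] := p_dist m; rewrite (ger0_norm (p0 s)).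
apply: le_trans (ler_piMl (normr_ge0 _) (distribution_le1 s (p_dist m))) _.
have Gosc : osc_le (propagate Q m L (indicator s))
    ((1 - alpha k ^+ n) ^+ (L %/ n) * 1).
  apply: osc_le_switching (osc_le_indicator s) => //.
  by apply/ltnW/(leq_ltn_trans _ jk); rewrite -leq_subRL ltnW.
(* The covariance compares two averages of one function: against the point mass at [s] and against
   [p m]. *)
have dist : is_distribution (indicator s).
  split=> [x|]; first exact: ler0n.
  by under eq_bigr do rewrite -[indicator s _]mul1r; rewrite sum_indicator.
have := osc_le_average Gosc dist (p_dist m); rewrite mulr1 addnC p_propagate.
congr (`| _ - _| <= _); rewrite -[RHS]sum_indicator.
by apply: eq_bigr => x _; rewrite mulrC.
Qed.

End SwitchingChain.

(** * Laws of Markov chains *)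

Section FiniteValued.
Variables (d : measure_display) (Om : measurableType d) (R : realType).
Variable P : probability Om R.

Definition pr (A : set Om) : R := fine (P A).

Lemma prE A : measurable A -> P A = (pr A)%:E.
Proof. by move=> mA; rewrite /pr fineK// fin_num_measure. Qed.

Lemma pr_ge0 A : 0 <= pr A.
Proof. by rewrite fine_ge0. Qed.

Lemma le_pr A B : measurable A -> measurable B -> A `<=` B -> pr A <= pr B.
Proof. by move=> mA mB AB; rewrite -lee_fin -!prE// le_measure ?inE. Qed.

Lemma prT : pr setT = 1.
Proof. by rewrite /pr probability_setT. Qed.

Lemma pr_le1 A : measurable A -> pr A <= 1.
Proof. by move=> mA; rewrite -prT le_pr. Qed.

Lemma pr_finite_rv (F : finType) (Y : Om -> F) B : measurable B -> finite_rv Y ->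
  pr B = \sum_y pr (B `&` Y @^-1` [set y]).
Proof.
move=> mB mY; apply: EFin_inj; rewrite -sumEFin -prE//.
transitivity (P (\bigcup_(y in [set` enum F]) (B `&` Y @^-1` [set y]))).
  congr (P _); apply/seteqP; split=> [w Bw|w [y _ []//]].
  by exists (Y w) => //=; rewrite mem_enum.
rewrite measure_fin_bigcup//=; first last.
- by move=> y _; apply: measurableI => //; exact: mY.
- by move=> y z _ _ [w [[_ /= <-] [_ /= <-]]].
rewrite -fsbig_seq ?enum_uniq// big_enum/=.
by apply: eq_bigr => y _; rewrite prE//; apply: measurableI => //; exact: mY.
Qed.

Lemma finite_rv_finfun (I F : finType) (Y : I -> Om -> F) :
  (forall i, finite_rv (Y i)) -> finite_rv (fun w => [ffun i => Y i w]).
Proof.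
move=> mY y; rewrite (_ : _ @^-1` _ = \bigcap_(i in [set: I]) Y i @^-1` [set y i]).
  by apply: fin_bigcap_measurable => // i _; exact: mY.
apply/seteqP; split=> [w /= <- i _|w H /=]; first by rewrite /= ffunE.
by apply/ffunP => i; rewrite ffunE; exact: H.
Qed.

Lemma finite_rv_mem (A : set Om) : measurable A -> finite_rv (fun w => `[< A w >]).
Proof.
move=> mA [].
  rewrite (_ : _ @^-1` _ = A)//; apply/seteqP.
  by split=> w /= => [/asboolP|?]//; apply/asboolP.
rewrite (_ : _ @^-1` _ = ~` A); first exact: measurableC.
by apply/seteqP; split=> w /= => [/asboolPn|?]//; apply/asboolPn.
Qed.

Lemma integral_finite_rv (F : finType) (Y : Om -> F) (g : F -> R) :
  finite_rv Y -> (forall y, 0 <= g y) ->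
  (\int[P]_w (g (Y w))%:E = (\sum_y g y * pr (Y @^-1` [set y]))%:E)%E.
Proof.
move=> mY g0.
under eq_integral => w _.
  rewrite (_ : (g (Y w))%:E =
     (\sum_(y <- index_enum F) (g y * \1_(Y @^-1` [set y]) w)%:E)%E); first over.
  rewrite sumEFin (bigD1 (Y w))//= indicE mem_set//= mulr1 big1 ?addr0// => y yY.
  by rewrite indicE memNset ?mulr0//= => Yw; rewrite Yw eqxx in yY.
rewrite ge0_integral_sum//=; last 2 first.
- move=> y; apply/measurable_EFinP; apply: measurable_funM => //.
- by move=> y w _; rewrite lee_fin mulr_ge0.
rewrite -sumEFin; apply: eq_bigr => y _.
under eq_integral do rewrite EFinM.
rewrite ge0_integralZl_EFin//; last first.
  by apply/measurable_EFinP; apply: measurable_indic; exact: mY.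
by rewrite integral_indic// setIT EFinM -prE.
Qed.

Lemma measurable_finite_rv (F : finType) (Y : Om -> F) (g : F -> R) :
  finite_rv Y -> measurable_fun setT (g \o Y).
Proof.
move=> mY _ B mB; rewrite setTI.
rewrite (_ : _ @^-1` _ = \bigcup_(y in [set y | B (g y)]) Y @^-1` [set y]).
  by apply: fin_bigcup_measurable => // y _; exact: mY.
apply/seteqP; split=> [w /= Bw|w [y /= By Yw]]; first by exists (Y w).
by rewrite /= Yw.
Qed.

End FiniteValued.

Section MarkovLaw.
Variables (d : measure_display) (Om : measurableType d) (R : realType).
Variable P : probability Om R.
Variables (T : finType) (Q : nat -> T -> T -> R) (X : nat -> Om -> T).
Hypothesis X_Markov : Markov_chain P Q X.

Definition history t (x : nat -> T) : set Om :=
  [set w | forall i, (i <= t)%N -> X i w = x i].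

Let mX t : finite_rv (X t). Proof. exact: X_Markov.1. Qed.

Lemma measurable_history t x : measurable (history t x).
Proof.
rewrite (_ : history t x = \bigcap_(i in `I_t.+1) (X i @^-1` [set x i])).
  by apply: fin_bigcap_measurable => [|i _]; [exact: finite_II|exact: mX].
by apply/seteqP; split=> w H i; exact: H.
Qed.

Lemma historyS t x :
  history t.+1 x = X t.+1 @^-1` [set x t.+1] `&` history t x.
Proof.
apply/seteqP; split=> [w H|w [/= Xw H] i].
  by split=> [|i it]; apply: H => //; exact: leqW.
by rewrite leq_eqVlt => /orP[/eqP->//|]; exact: H.
Qed.

Lemma pr_historyS t x :
  pr P (history t.+1 x) = pr P (history t x) * Q t (x t) (x t.+1).
Proof.
have mH := measurable_history t x; have mH' := measurable_history t.+1 x.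
(* The Markov property says nothing about a null past, but then both sides vanish. *)
have [P0|Pn0] := eqVneq (P (history t x)) 0%E.
  rewrite {2}/pr P0 mul0r; apply/eqP; rewrite eq_le pr_ge0 andbT.
  rewrite -(_ : pr P (history t x) = 0); last by rewrite /pr P0.
  by apply: le_pr => //; rewrite historyS; exact: subIsetr.
have := X_Markov.2 t x Pn0.
rewrite /cond_prob -/(history t x) -historyS => <-.
rewrite -/(pr P (history t x)) -/(pr P (history t.+1 x)) mulrC divfK//.
by apply: contra Pn0 => /eqP H; rewrite prE// H.
Qed.

Let indicator (s x : T) : R := (x == s)%:R.

Lemma pr_history_propagate L t x s :
  pr P (history t x `&` X (t + L) @^-1` [set s]) =
  pr P (history t x) * propagate Q t L (indicator s) (x t).
Proof.
elim: L t x => [|L IH] t x /=.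
  rewrite addn0 /indicator; have [xs|xs] := eqVneq (x t) s.
    rewrite mulr1; congr (pr P _); apply: setIidl => w H /=.
    by rewrite H.
  rewrite mulr0 (_ : _ `&` _ = set0); first by rewrite /pr measure0.
  by apply/seteqP; split=> // w [H /= Xs]; rewrite -Xs H ?eqxx in xs.
have mB : measurable (history t x `&` X (t + L.+1) @^-1` [set s]).
  by apply: measurableI; [exact: measurable_history|exact: mX].
rewrite (pr_finite_rv P mB (mX t.+1)) mulr_sumr; apply: eq_bigr => y _.
(* The history prolonged by the value [y], to which the induction hypothesis applies. *)
pose x' i := if i == t.+1 then y else x i.
have x't i : (i <= t)%N -> x' i = x i.
  by move=> it; rewrite /x' ltn_eqF.
have x'S : x' t.+1 = y by rewrite /x' eqxx.
have Ht : history t x = history t x'.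
  by apply/seteqP; split=> w H i it; rewrite H// x't.
have := IH t.+1 x'; rewrite pr_historyS x'S x't// -Ht mulrA => <-.
congr (pr P _); rewrite historyS x'S -Ht addSnnS.
by apply/seteqP; split=> w [[? ?] ?].
Qed.

(** The Markov property concerns whole histories; those ending at [a] all give the same transition
    factor, which comes out of the sum over them. *)
Lemma pr_Markov t L a s :
  pr P (X t @^-1` [set a] `&` X (t + L) @^-1` [set s]) =
  pr P (X t @^-1` [set a]) * propagate Q t L (indicator s) a.
Proof.
pose Y w := [ffun i : 'I_t.+1 => X i w].
have mY : finite_rv Y by apply: finite_rv_finfun => i; exact: mX.
have mA := mX t a.
have mB : measurable (X t @^-1` [set a] `&` X (t + L) @^-1` [set s]).
  by apply: measurableI => //; exact: mX.
rewrite (pr_finite_rv P mB mY) (pr_finite_rv P mA mY) mulr_suml.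
apply: eq_bigr => y _.
(* [inord] is exact on the indices up to [t], the only ones read by [history t]. *)
pose x i := y (inord i).
have YE : Y @^-1` [set y] = history t x.
  apply/seteqP; split=> w /=; first by move=> Yw i it; rewrite /x -Yw ffunE inordK.
  by move=> H; apply/ffunP => i; rewrite ffunE H ?leq_ord// /x inord_val.
rewrite YE; have [xa|xa] := eqVneq (x t) a.
  have HX : X t @^-1` [set a] `&` history t x = history t x.
    by apply: setIidr => w H /=; rewrite H.
  by rewrite setIAC HX -xa pr_history_propagate.
have H0 : X t @^-1` [set a] `&` history t x = set0.
  by apply/seteqP; split=> // w [/= Xa H]; rewrite -Xa H ?eqxx in xa.
by rewrite setIAC H0 set0I /pr measure0 mul0r.
Qed.

Lemma law_distribution t : is_distribution (fun s => pr P (X t @^-1` [set s])).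
Proof.
split=> [s|]; first exact: pr_ge0.
rewrite -[RHS](prT P) (pr_finite_rv P measurableT (mX t)).
by apply: eq_bigr => s _; rewrite setTI.
Qed.

Lemma law_propagate t L s : pr P (X (t + L) @^-1` [set s]) =
  \sum_x pr P (X t @^-1` [set x]) * propagate Q t L (indicator s) x.
Proof.
rewrite (pr_finite_rv P (mX _ _) (mX t)); apply: eq_bigr => x _.
by rewrite setIC pr_Markov.
Qed.

(** A zero matrix at time 0 would give the law at time 1 total mass 0. In the theorem this forces
    [tau h 1 = 0]. *)
Lemma Markov_chain_not_null : ~ forall x y, Q 0 x y = 0.
Proof.
move=> Q0; have [_] := law_distribution 1.
rewrite big1 => [/eqP|s _]; first by rewrite eq_sym oner_eq0.
have := law_propagate 0 1 s; rewrite add0n => ->.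
by rewrite big1// => x _; rewrite /= big1 ?mulr0// => y _; rewrite Q0 mul0r.
Qed.

End MarkovLaw.

(** * A strong law of large numbers for weakly correlated events *)

(** Telescoping of [1/(x + 1)^2 <= 1/x - 1/(x + 1)]; at [n = 0] the inverse is 0 by convention. *)
Lemma sum_inv_sqr_le (R : realType) n :
  \sum_(0 <= j < n) (j.+1%:R ^+ 2)^-1 <= 2 - n%:R^-1 :> R.
Proof.
elim: n => [|[_|n IH]]; first by rewrite big_nil invr0 subr0.
  by rewrite big_nat1 invr1 expr1n invr1; lra.
rewrite big_nat_recr//=; apply: le_trans (lerD IH (lexx _)) _.
have n0 : 0 < n.+1%:R :> R by rewrite ltr0n.
rewrite (_ : n.+2%:R = n.+1%:R + 1); last by rewrite natr1.
set x : R := n.+1%:R in n0 *.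
have x1 : 0 < x + 1 by lra.
rewrite -addrA lerD2l -subr_ge0.
have -> : - (x + 1)^-1 - (- x^-1 + ((x + 1) ^+ 2)^-1) = (x * (x + 1) ^+ 2)^-1.
  by field; rewrite !gt_eqF.
by rewrite invr_ge0 mulr_ge0 ?sqr_ge0// ltW.
Qed.

(** Factors are exchanged one at a time, the others staying in [0, 1]. This passes covariance bounds
    from the blocks to the joint process. *)
Lemma norm_prodB_le (R : realType) (I : Type) (r : seq I) (x y : I -> R) :
  (forall i, 0 <= x i <= 1) -> (forall i, 0 <= y i <= 1) ->
  `|\prod_(i <- r) x i - \prod_(i <- r) y i| <= \sum_(i <- r) `|x i - y i|.
Proof.
move=> x01 y01.
suff [] : [/\ 0 <= \prod_(i <- r) x i <= 1, 0 <= \prod_(i <- r) y i <= 1 &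
  `|\prod_(i <- r) x i - \prod_(i <- r) y i| <= \sum_(i <- r) `|x i - y i|] by [].
elim: r => [|i r [/andP[X0 X1] /andP[Y0 Y1] IH]].
  by rewrite !big_nil subrr normr0 lexx ler01.
rewrite !big_cons; have [/andP[x0 x1] /andP[y0 y1]] := (x01 i, y01 i).
split; [by apply/andP; split; [exact: mulr_ge0|exact: mulr_ile1]..|].
set X := \prod_(i <- r) x i in X0 X1 IH *; set Y := \prod_(i <- r) y i in Y0 Y1 IH *.
rewrite (_ : _ - _ = x i * (X - Y) + (x i - y i) * Y); last by ring.
apply: le_trans (ler_normD _ _) _; rewrite addrC !normrM.
rewrite (ger0_norm x0) (ger0_norm Y0); apply: lerD.
  by rewrite ler_piMr.
by apply: le_trans IH; rewrite ler_piMl.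
Qed.

(** Between [k^4] and [(k + 1)^4] there are at most [(4 + 6 + 4 + 1) k^3 = 15 k^3] terms, each at
    most 1 in absolute value: a share [15/k] of the average. *)
Lemma average_cvg0_pow4 (R : realType) (x : nat -> R) :
  (forall m, `|x m| <= 1) ->
  (fun j => (j.+1 ^ 4)%:R^-1 * \sum_(0 <= m < j.+1 ^ 4) x m) @ \oo --> 0 ->
  (fun t => t%:R^-1 * \sum_(0 <= m < t) x m) @ \oo --> 0.
Proof.
move=> x1 /cvgr0Pnorm_le H; apply/cvgr0Pnorm_le => ep ep0.
have ep2 : 0 < ep / 2 by rewrite divr_gt0.
have [J _ HJ] := H _ ep2.
(* [30 / ep] makes [15/k <= ep/2], and [J] makes the average up to [k^4] at most [ep/2]. *)
pose K := (J + (Num.truncn (30 / ep))).+1.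
exists (K.+1 ^ 4)%N => // t /= Kt.
have pow_incr l : (0 < l)%N -> (l ^ 4 < l.+1 ^ 4)%N by move=> _; rewrite ltn_exp2r.
have [|k k0 /andP[kt tk]] := @block_index (fun k => (k ^ 4)%N) pow_incr t.
  by apply: leq_trans Kt; rewrite leq_exp2r.
have Kk : (K < k.+1)%N.
  by rewrite -(@ltn_exp2r _ _ 4)// (leq_trans _ tk)// ltnS (leq_trans _ Kt)// leq_exp2r.
have kR : 0 < k%:R :> R by rewrite ltr0n.
have k1 : 1 <= k%:R :> R by rewrite ler1n.
have kep : 15 / k%:R <= ep / 2.
  rewrite ler_pdivrMr// mulrAC ler_pdivlMr// -(mulrC k%:R) -ler_pdivrMr//.
  have := truncnS_gt (30 / ep); rewrite -natrM.
  rewrite (_ : (15 * 2)%N = 30%N)// => /ltW/le_trans; apply.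
  by rewrite ler_nat; apply: leq_trans (_ : (K <= k)%N); rewrite ?ltnS ?leq_addl.
have k4 : 0 < (k ^ 4)%:R :> R by rewrite ltr0n expn_gt0 k0.
have t0 : 0 < t%:R :> R by apply: lt_le_trans k4 _; rewrite ler_nat.
have := HJ k.-1; rewrite /= prednK// => /(_ _) HS.
have {HS} : `|\sum_(0 <= m < k ^ 4) x m| <= ep / 2 * (k ^ 4)%:R.
  have : `|(k ^ 4)%:R^-1 * \sum_(0 <= m < k ^ 4) x m| <= ep / 2.
    apply: HS; rewrite -ltnS prednK//.
    by apply: leq_trans (_ : (K <= k)%N); rewrite ?ltnS ?leq_addr.
  by rewrite normrM gtr0_norm ?invr_gt0// mulrC ler_pdivrMr.
set S := \sum_(0 <= m < k ^ 4) x m => HS.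
have HT : `|\sum_(k ^ 4 <= m < t) x m| <= 15 / k%:R * (k ^ 4)%:R.
  apply: le_trans (ler_norm_sum _ _ _) _.
  apply: le_trans (_ : \sum_(k ^ 4 <= m < t) (1 : R) <= _); first exact: ler_sum.
  rewrite sumr_const_nat natrB//.
  have : t%:R <= (k.+1 ^ 4)%:R :> R by rewrite ler_nat ltnW.
  rewrite !natrX -natr1 (_ : 15 / k%:R * k%:R ^+ 4 = 15 * k%:R ^+ 3); last first.
    by field; rewrite gt_eqF.
  move: k1; move: (k%:R : R) => y y1.
  have y2 : y <= y ^+ 2 by rewrite expr2 ler_peMl//; lra.
  have y3 : y ^+ 2 <= y ^+ 3 by rewrite (exprS _ 2) ler_peMl// sqr_ge0.
  by rewrite (_ : (y + 1) ^+ 4 = y ^+ 4 + 4 * y ^+ 3 + 6 * y ^+ 2 + 4 * y + 1); [lra|ring].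
rewrite (@big_cat_nat _ _ _ (k ^ 4))//= -/S normrM gtr0_norm ?invr_gt0// mulrC.
rewrite ler_pdivrMr//; apply: le_trans (ler_normD _ _) _.
apply: le_trans (lerD HS HT) _.
apply: le_trans (_ : ep * (k ^ 4)%:R <= _).
  by rewrite -mulrDl ler_pM2r//; lra.
by rewrite ler_pM2l// ler_nat.
Qed.

Section StrongLaw.
Variables (d : measure_display) (Om : measurableType d) (R : realType).
Variable P : probability Om R.

Lemma pr_finite_event (F : finType) (Y : Om -> F) (B : set Om) (beta : pred F) :
  finite_rv Y -> measurable B -> (forall w, B w <-> beta (Y w)) ->
  pr P B = \sum_y (beta y)%:R * pr P (Y @^-1` [set y]).
Proof.
move=> mY mB BE; rewrite (pr_finite_rv P mB mY); apply: eq_bigr => y _.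
case: (boolP (beta y)) => by_; rewrite ?mul1r ?mul0r.
  congr (pr P _); apply/seteqP; split=> [w []//|w /= Yw].
  by split=> //; apply/BE; rewrite Yw.
rewrite (_ : _ `&` _ = set0); first by rewrite /pr measure0.
by apply/seteqP; split=> // w [/BE + /= Yw]; rewrite Yw (negPf by_).
Qed.

(** By monotone convergence the series has a finite integral, so it converges almost everywhere and
    its terms tend to 0. *)
Lemma ae_cvg0_summable (f : nat -> Om -> R) (M : R) :
  (forall j, measurable_fun setT (f j)) -> (forall j w, 0 <= f j w) ->
  (forall n, (\sum_(0 <= j < n) \int[P]_w (f j w)%:E <= M%:E)%E) ->
  \forall w \ae P, f ^~ w @ \oo --> 0.
Proof.
move=> mf f0 fM.
pose g w := (\big[+%E/0%E]_(0 <= j <oo) (f j w)%:E)%E.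
have mf' j : measurable_fun setT (fun w => (f j w)%:E) by apply/measurable_EFinP.
have g0 w : (0 <= g w)%E by apply: nneseries_ge0 => j _ _; rewrite lee_fin.
have int_g : P.-integrable setT g.
  apply/integrableP; split.
    by apply: ge0_emeasurable_sum => // j w _ _; rewrite lee_fin.
  under eq_integral do rewrite gee0_abs//.
  rewrite integral_nneseries//; last by move=> j w _; rewrite lee_fin.
  apply: le_lt_trans (ltry M); apply: lime_le.
    apply: is_cvg_nneseries => j _ _.
    by apply: integral_ge0 => w _; rewrite lee_fin.
  by apply: nearW => n; exact: fM.
apply: filterS (integrable_ae measurableT int_g) => w /(_ I) gw.
apply: cvg_series_cvg_0; apply: nondecreasing_is_cvgn.
  apply: nondecreasing_series => j _ _; exact: f0.
exists (fine (g w)) => _ [n _ <-].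
rewrite -lee_fin fineK// /series/= -sumEFin.
by apply: nneseries_lim_ge => j _ _; rewrite lee_fin.
Qed.

Variable A : nat -> set Om.
Hypothesis mA : forall t, measurable (A t).

Let a t := pr P (A t).
Let cov m t := pr P (A m `&` A t) - a m * a t.
Let centered m w : R := (`[< A m w >])%:R - a m.

(** The vector of the first [n] indicators takes finitely many values, so the integral is a finite
    sum in which the square expands into covariances. *)
Lemma integral_centered_sqr n :
  (\int[P]_w ((\sum_(0 <= m < n) centered m w) ^+ 2)%:E =
   (\sum_(i < n) \sum_(k < n) cov i k)%:E)%E.
Proof.
pose Y w := [ffun i : 'I_n => `[< A i w >]].
have mY : finite_rv Y by apply: finite_rv_finfun => i; exact: finite_rv_mem.
pose g (y : {ffun 'I_n -> bool}) := (\sum_(i < n) ((y i)%:R - a i)) ^+ 2.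
under eq_integral => w _.
  rewrite (_ : _ ^+ 2 = g (Y w)); first over.
  by rewrite /g big_mkord; congr (_ ^+ 2); apply: eq_bigr => i _; rewrite ffunE.
rewrite (integral_finite_rv P mY) => [|y]; last exact: sqr_ge0.
congr (_%:E); pose pi (y : {ffun 'I_n -> bool}) := pr P (Y @^-1` [set y]).
have mean (i : 'I_n) : a i = \sum_(y : {ffun 'I_n -> bool}) (y i)%:R * pi y.
  apply: (pr_finite_event (beta := fun y : {ffun 'I_n -> bool} => y i) mY (mA i)).
  by move=> w; rewrite ffunE; split=> /asboolP.
have mean2 (i k : 'I_n) :
    pr P (A i `&` A k) = \sum_(y : {ffun 'I_n -> bool}) (y i && y k)%:R * pi y.
  apply: (pr_finite_event (beta := fun y : {ffun 'I_n -> bool} => y i && y k) mY).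
    exact: measurableI.
  move=> w; rewrite !ffunE; split; first by case=> /asboolP -> /asboolP ->.
  by case/andP=> /asboolP ? /asboolP.
have mass : \sum_y pi y = 1.
  rewrite -(prT P) (pr_finite_rv P measurableT mY).
  by apply: eq_bigr => y _; rewrite setTI.
rewrite (eq_bigr (fun y : {ffun 'I_n -> bool} => \sum_(i < n) \sum_(k < n)
    ((y i)%:R - a i) * ((y k)%:R - a k) * pi y)); last first.
  move=> y _; rewrite /g expr2 !mulr_suml; apply: eq_bigr => i _.
  by rewrite mulr_sumr mulr_suml.
rewrite exchange_big/=; apply: eq_bigr => i _.
rewrite exchange_big/=; apply: eq_bigr => k _.
rewrite /cov mean2 (eq_bigr (fun y : {ffun 'I_n -> bool} => (y i && y k)%:R * pi y -
    a k * ((y i)%:R * pi y) - a i * ((y k)%:R * pi y) + a i * a k * pi y)).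
  by rewrite big_split/= !sumrB -!mulr_sumr -!mean mass; ring.
by move=> y _; rewrite -mulnb natrM; ring.
Qed.

Variable C : R.
Hypothesis C_ge0 : 0 <= C.
Hypothesis cov_le : forall j m, (m < j ^ 4)%N ->
  \sum_(m <= t < j ^ 4) `|cov m t| <= C * j%:R ^+ 2.

(** By symmetry the double sum is at most twice its upper triangle, whose [j^4] rows are each at
    most [C j^2]. *)
Lemma sum_cov_le j :
  \sum_(i < j ^ 4) \sum_(k < j ^ 4) cov i k <= 2 * C * j%:R ^+ 6.
Proof.
set n := (j ^ 4)%N.
have half : \sum_(i < n) \sum_(k < n | (i <= k)%N) `|cov i k| <= C * j%:R ^+ 6.
  apply: le_trans (_ : \sum_(i < n) C * j%:R ^+ 2 <= _).
    apply: ler_sum => i _; apply: le_trans (cov_le (ltn_ord i)).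
    by rewrite big_geq_mkord.
  rewrite sumr_const card_ord -[_ *+ n]mulr_natr natrX -mulrA -exprD.
  by [].
apply: le_trans (_ : \sum_(i < n) \sum_(k < n)
    ((if (i <= k)%N then `|cov i k| else 0) + (if (k <= i)%N then `|cov k i| else 0)) <= _).
  apply: ler_sum => i _; apply: ler_sum => k _.
  have covC : cov k i = cov i k by rewrite /cov setIC mulrC.
  rewrite covC; have := ler_norm (cov i k); have := normr_ge0 (cov i k).
  by case: (leqP i k); case: (leqP k i); lia || lra.
under eq_bigr do rewrite big_split/=.
rewrite big_split/= [X in _ + X]exchange_big/=.
have E : \sum_(i < n) \sum_(k < n) (if (i <= k)%N then `|cov i k| else 0) <= C * j%:R ^+ 6.
  by under eq_bigr do rewrite -big_mkcond/=.
by lra.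
Qed.

Lemma strong_law (l : R) : a @ \oo --> l ->
  \forall w \ae P,
    (fun t => t%:R^-1 * \sum_(0 <= m < t) (`[< A m w >])%:R) @ \oo --> l.
Proof.
move=> al.
pose Z j w := (j.+1 ^ 4)%:R^-1 * \sum_(0 <= m < j.+1 ^ 4) centered m w.
have mcentered m : measurable_fun setT (centered m).
  apply: measurable_funB => //.
  exact: (measurable_finite_rv (fun b : bool => b%:R : R) (finite_rv_mem (mA m))).
have mZ j : measurable_fun setT (Z j).
  by apply: measurable_funM => //; apply: measurable_sum.
(* The normalization to the power -8 against the sixth power in [sum_cov_le] leaves a summable
   inverse square. *)
have Zint j : (\int[P]_w ((Z j w) ^+ 2)%:E <= (2 * C * (j.+1%:R ^+ 2)^-1)%:E)%E.
  under eq_integral do rewrite exprMn EFinM.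
  rewrite ge0_integralZl_EFin ?sqr_ge0//; last 2 first.
  - by move=> w _; rewrite lee_fin sqr_ge0.
  - apply/measurable_EFinP; apply: measurable_funX; exact: measurable_sum.
  rewrite integral_centered_sqr -EFinM lee_fin.
  apply: le_trans (ler_wpM2l (sqr_ge0 _) (sum_cov_le j.+1)) _.
  rewrite natrX le_eqVlt; apply/orP; left; apply/eqP; field.
  by rewrite gt_eqF ?ltr0n.
have Z0 : \forall w \ae P, (fun j => Z j w ^+ 2) @ \oo --> 0.
  apply: (@ae_cvg0_summable (fun j w => Z j w ^+ 2) (4 * C)).
  - by move=> j; exact: measurable_funX.
  - by move=> j w; exact: sqr_ge0.
  - move=> n; apply: le_trans (lee_sum _ (fun j _ => Zint j)) _.
    rewrite sumEFin lee_fin -mulr_sumr.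
    have := sum_inv_sqr_le R n; have : 0 <= n%:R^-1 :> R by rewrite invr_ge0.
    by move: (\sum_(_ <= _ < _) _) n%:R^-1 => x y; have := C_ge0; nra.
apply: filterS Z0 => w Zw.
have cw : (fun t => t%:R^-1 * \sum_(0 <= m < t) centered m w) @ \oo --> 0.
  apply: average_cvg0_pow4.
    move=> m; rewrite /centered; have := pr_ge0 P (A m); have := pr_le1 P (mA m).
    by rewrite -/(a m) ler_norml; case: asboolP => _; rewrite ?mulr1n ?mulr0n; lra.
  apply/cvgr0Pnorm_le => ep ep0.
  have ep2 : 0 < ep ^+ 2 by rewrite exprn_gt0.
  move/cvgr0Pnorm_le : Zw => /(_ _ ep2); apply: filterS => j /=.
  by rewrite normrX ler_pXn2r ?nnegrE// ltW.
(* The subtracted means are restored through their Cesaro limit. *)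
have mean : (fun t => t%:R^-1 * \sum_(0 <= m < t) a m) @ \oo --> l.
  by rewrite -cvg_shiftS; exact: (cesaro al).
rewrite -[l]add0r.
rewrite (_ : (fun t => _) = (fun t => t%:R^-1 * \sum_(0 <= m < t) centered m w +
    t%:R^-1 * \sum_(0 <= m < t) a m)); first exact: (cvgD cw mean).
apply/funext => t /=; rewrite -mulrDr -big_split/=; congr (_ * _).
by apply: eq_bigr => m _; rewrite /centered subrK.
Qed.

End StrongLaw.

(** * Product graphs and independent processes *)

Section ProductGraph.
Variables (I : finType) (T : I -> finType).
Variables (e : rel {dffun forall i, T i}) (eC : forall i, rel (T i)).

Definition set_coordinate (s : {dffun forall i, T i}) i (x : T i) :
  {dffun forall i, T i} := finfun (dfwith s i x).
Arguments set_coordinate s [i] x.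

Lemma set_coordinateE s i x : set_coordinate s x i = x.
Proof. by rewrite ffunE dfwithin. Qed.

(** Vertices of the factor are lifted over a base point; along a path of the product, successive
    [i]-th coordinates are equal or joined by an edge. *)
Lemma C_decomposition_connected i : (forall i, T i) ->
  connected_graph e -> C_decomposition e eC -> connected_graph (@eC i).
Proof.
move=> s0 econn edec x y; pose s : {dffun forall i, T i} := finfun s0.
rewrite -(set_coordinateE s x) -(set_coordinateE s y).
have /connectP[p] := econn (set_coordinate s x) (set_coordinate s y).
elim: p (set_coordinate s x) => [|v p IH] u /=; first by move=> _ ->.
case/andP=> uv vp yE; apply: connect_trans (IH v vp yE).
have /edec/(_ i)/orP[/eqP->|] : Defs.adjacent e u v by rewrite /Defs.adjacent uv orbT.
  exact: connect0.
exact: connect1.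
Qed.

Lemma card_coordinate_le i : (forall i, T i) ->
  (#|T i| <= #|{: {dffun forall i, T i}}|)%N.
Proof.
move=> s0; pose s : {dffun forall i, T i} := finfun s0.
apply: (@leq_card _ _ (fun x => set_coordinate s x)) => x y xy.
by rewrite -(set_coordinateE s x) xy set_coordinateE.
Qed.

End ProductGraph.

Lemma sigma_process_event (d : measure_display) (Om : measurableType d)
  (T : finType) (Y : nat -> Om -> T) t x : sigma_process Y (Y t @^-1` [set x]).
Proof. by apply: sub_sigma_algebra; exists t, x. Qed.

Lemma sigma_processI (d : measure_display) (Om : measurableType d)
  (T : finType) (Y : nat -> Om -> T) A B :
  sigma_process Y A -> sigma_process Y B -> sigma_process Y (A `&` B).
Proof.
exact: (@measurableI _ (g_sigma_algebraType
  [set A | exists t x, A = Y t @^-1` [set x]])).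
Qed.

Section IndependentProcesses.
Variables (d : measure_display) (Om : measurableType d) (R : realType).
Variable P : probability Om R.
Variables (I : finType) (T : I -> finType) (Y : forall i, nat -> Om -> T i).
Hypothesis Y_indep : independent_processes P Y.

Lemma pr_independent_bigcap (A : I -> set Om) :
  (forall i, sigma_process (Y i) (A i)) ->
  pr P (\bigcap_i A i) = \prod_i pr P (A i).
Proof.
move=> mA; have := Y_indep (J := [set: I]%SET) (A := A) (fun i _ => mA i).
rewrite (_ : [set` [set: I]%SET] = setT); last by apply/seteqP; split=> i //= _; rewrite inE.
by rewrite /pr => ->; apply: eq_bigl => i; rewrite inE.
Qed.

End IndependentProcesses.

(** * Assembly of the independent block chains *)

Theorem theorem4 (R : realType)
  (V : finType) (r : nat) (C : 'I_r -> {set V})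
  (C_inj : injective C)
  (C_partition : finset.partition [set C h | h : 'I_r]%SET [set: V]%SET)
  (S : V -> finType)
  (E : rel {dffun forall h : 'I_r, block_space S (C h)})
  (E_simple : simple_graph E)
  (E_connected : connected_graph E)
  (EC : forall h : 'I_r, rel (block_space S (C h)))
  (EC_simple : forall h, simple_graph (EC h))
  (E_decomposition : C_decomposition E EC)
  (muC : forall h : 'I_r, block_space S (C h) -> R)
  (muC_distribution : forall h, is_distribution (muC h))
  (muC_disconnected : forall h,
     ~ connected_graph (induced_subgraph (EC h) (dsupport (muC h))))
  (mu : {dffun forall h : 'I_r, block_space S (C h)} -> R)
  (mu_product : forall s, mu s = \prod_(h < r) muC h (s h))
  (lab : forall h : 'I_r, block_space S (C h) -> 'I_#|block_space S (C h)|)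
  (lab_decreasing : forall h, decreasing_labelling (muC h) (lab h))
  (tau : 'I_r -> nat -> nat)
  (tau_increasing : forall h l, (0 < l)%N -> (tau h l < tau h l.+1)%N)
  (c : R) (c_gt0 : 0 < c)
  (tau_gap : forall h l, (0 < l)%N ->
     c * l%:R ^+ (5 * #|{: {dffun forall h : 'I_r, block_space S (C h)}}| - 1)
     <= (tau h l.+1)%:R - (tau h l)%:R)
  (d : measure_display) (Om : measurableType d) (P : probability Om R)
  (XC : forall h : 'I_r, nat -> Om -> block_space S (C h))
  (XC_Markov : forall h, Markov_chain P
     (switching_matrix (muC h) (lab h) (EC h) (tau h)) (XC h))
  (XC_independent : independent_processes P XC)
  (X : nat -> Om -> {dffun forall h : 'I_r, block_space S (C h)})
  (X_def : forall t w h, X t w h = XC h t w) :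
  \forall w \ae P, forall s : {dffun forall h : 'I_r, block_space S (C h)},
    [/\ (fun t : nat => t%:R^-1 * \sum_(0 <= m < t) (X m w == s)%:R) @ \oo
          --> \prod_(h < r) muC h (s h),
        (fun t : nat => t%:R^-1 *
           \sum_(0 <= m < t) \prod_(h < r) (XC h m w == s h)%:R) @ \oo
          --> \prod_(h < r) muC h (s h)
      & \prod_(h < r) muC h (s h) = mu s].
Proof.
set N := #|_| in tau_gap.
(* An empty block would make the induced subgraph vacuously connected. *)
have pt h : block_space S (C h).
  case: (pickP (fun _ : block_space S (C h) => true)) => [//|H].
  by exfalso; apply: (muC_disconnected h) => u; have := H (val u).
have econn h : connected_graph (EC h).
  exact: C_decomposition_connected pt E_connected E_decomposition.
have cardN h : (#|block_space S (C h)| <= N)%N by exact: card_coordinate_le.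
have card_gt0 h : (0 < #|block_space S (C h)|)%N.
  exact: card_disconnected_gt0 (muC_disconnected h).
have lab_inj h : injective (lab h) := (lab_decreasing h).1.
(* Before time [tau h 1] the switching matrix is zero, which no chain can have. *)
have tau1 h : tau h 1 = 0%N.
  apply/eqP; rewrite -leqn0 leqNgt; apply/negP => tau0.
  apply: (Markov_chain_not_null (XC_Markov h)) => x y.
  apply: lim_near_cst => //; apply: nearW => n; rewrite big_nat big1// => k /andP[k0 _].
  by rewrite leqn0 gtn_eqF ?mulr0// (leq_trans tau0)// blocks_le// => l; exact: tau_increasing.
have mX h t x : measurable (XC h t @^-1` [set x]) := (XC_Markov h).1 t x.
(* There are finitely many states, so the exceptional null set may depend on [s]. *)
apply: filter_forall => s.
pose B h t := XC h t @^-1` [set s h].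
pose A t := \bigcap_h B h t.
have mB h t : measurable (B h t) by exact: mX.
have mA t : measurable (A t) by apply: fin_bigcap_measurable.
have prA t : pr P (A t) = \prod_h pr P (B h t).
  apply: (pr_independent_bigcap XC_independent) => h.
  exact: (@sigma_process_event _ _ _ (XC h) t (s h)).
have prAA m t : pr P (A m `&` A t) = \prod_h pr P (B h m `&` B h t).
  rewrite -bigcapI; apply: (pr_independent_bigcap XC_independent) => h.
  apply: sigma_processI; first exact: (@sigma_process_event _ _ _ (XC h) m (s h)).
  exact: (@sigma_process_event _ _ _ (XC h) t (s h)).
have prA_cvg : (fun t => pr P (A t)) @ \oo --> \prod_h muC h (s h).
  under eq_fun do rewrite prA.
  apply: cvg_big => [|h _]; first exact: mul_continuous.
  apply: (law_cvg (muC_distribution h) (EC_simple h) (econn h) (muC_disconnected h)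
    (lab_inj h) (tau_increasing h) (tau1 h) c_gt0 (tau_gap h)
    (law_distribution (XC_Markov h)) (law_propagate (XC_Markov h))).
  (* [5N - 1 >= 4N > 2n] for a block of size [n] with [1 <= n <= N]. *)
  by have := cardN h; have := card_gt0 h; lia.
have covB h : exists2 D : R, 0 <= D & forall j m, (m < j ^ 4)%N ->
    \sum_(m <= t < j ^ 4) `|pr P (B h m `&` B h t) - pr P (B h m) * pr P (B h t)|
    <= D * j%:R ^+ 2.
  have [|D D0 HD] := covariance_sum_le (muC_distribution h) (EC_simple h) (econn h)
    (muC_disconnected h) (lab_inj h) (tau_increasing h) (tau1 h) c_gt0 (tau_gap h)
    (law_distribution (XC_Markov h)) (law_propagate (XC_Markov h)) (s h).
    by have := cardN h; have := card_gt0 h; lia.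
  exists D => // j m mj; apply: le_trans (HD j m mj).
  rewrite big_nat [leRHS]big_nat; apply: ler_sum => t /andP[mt _].
  by rewrite -(pr_Markov (XC_Markov h)) subnKC.
(* One constant per block is selected; their sum serves for the joint process. *)
have [D HD] := choice (fun h => (let: ex_intro2 D D0 HD := covB h in
  ex_intro (fun D => 0 <= D /\ _) D (conj D0 HD))).
have cov_le j m : (m < j ^ 4)%N -> \sum_(m <= t < j ^ 4)
    `|pr P (A m `&` A t) - pr P (A m) * pr P (A t)| <= (\sum_h D h) * j%:R ^+ 2.
  move=> mj; apply: le_trans (_ : \sum_(m <= t < j ^ 4) \sum_h
      `|pr P (B h m `&` B h t) - pr P (B h m) * pr P (B h t)| <= _).
    apply: ler_sum => t _; rewrite prAA !prA -big_split/=.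
    apply: norm_prodB_le => h.
      by rewrite pr_ge0 pr_le1//; exact: measurableI.
    by rewrite mulr_ge0 ?pr_ge0// mulr_ile1 ?pr_ge0 ?pr_le1.
  by rewrite exchange_big mulr_suml; apply: ler_sum => h _; exact: (HD h).2.
have D0 : 0 <= \sum_h D h by apply: sumr_ge0 => h _; exact: (HD h).1.
apply: filterS (strong_law mA D0 cov_le prA_cvg) => w.
have E1 m : (X m w == s)%:R = (`[< A m w >])%:R :> R.
  congr (nat_of_bool _)%:R; apply/eqP/asboolP => [Xs h _|H].
    by rewrite /B /= -Xs X_def.
  by apply/ffunP => h; rewrite X_def; exact: H.
have E2 m : \prod_(h < r) (XC h m w == s h)%:R = (X m w == s)%:R :> R.
  have [Xs|Xs] := eqVneq (X m w) s.
    by rewrite big1// => h _; rewrite -X_def Xs eqxx.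
  have [h Xh] : exists h, X m w h != s h.
    apply: contrapT => /forallNP H; case/eqP: Xs; apply/ffunP => h.
    by apply/eqP; have /negP/negPn := H h.
  by rewrite (bigD1 h)//= -X_def (negPf Xh) mul0r.
move=> cvgA; split=> //.
- by under eq_fun do under eq_bigr do rewrite E1.
- by under eq_fun do under eq_bigr do rewrite E2 E1.
Qed.
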